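(* Let $\gamma_1,\gamma_2,\gamma_3,\delta_1,\delta_2,\delta_3,x,y\in\mathbb{C}$, let $\alpha_1,\dots,\alpha_4,\beta_1,\dots,\beta_4$ be positive real numbers, and let $\mu\in\mathbb{C}$ with $\operatorname{Re}\mu>\operatorname{Re}\gamma_3>0$. Then $$D_1\left(\begin{matrix}\gamma_1,\alpha_1,\beta_1;\gamma_2,\alpha_2;\gamma_3,\beta_2;\\ \delta_1,\alpha_3,\beta_3;\delta_2,\alpha_4;\delta_3,\beta_4;\end{matrix}\left|\begin{matrix}x\\ y\end{matrix}\right.\right)=\frac{\Gamma(\mu)}{\Gamma(\gamma_3)\Gamma(\mu-\gamma_3)}\int_0^1\xi^{\gamma_3-1}(1-\xi)^{\mu-\gamma_3-1}D_1\left(\begin{matrix}\gamma_1,\alpha_1,\beta_1;\gamma_2,\alpha_2;\mu,\beta_2;\\ \delta_1,\alpha_3,\beta_3;\delta_2,\alpha_4;\delta_3,\beta_4;\end{matrix}\left|\begin{matrix}x\\ y\xi^{\beta_2}\end{matrix}\right.\right)d\xi.$$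
   Context: $(\gamma)_\lambda=\Gamma(\gamma+\lambda)/\Gamma(\gamma)$ for $\gamma\in\mathbb{C}$ and real $\lambda\ge0$. For complex $\gamma_i,\delta_i,x,y$ and positive real $\alpha_i,\beta_i$, $$D_1\left(\begin{matrix}\gamma_1,\alpha_1,\beta_1;\gamma_2,\alpha_2;\gamma_3,\beta_2;\\ \delta_1,\alpha_3,\beta_3;\delta_2,\alpha_4;\delta_3,\beta_4;\end{matrix}\left|\begin{matrix}x\\ y\end{matrix}\right.\right)=\sum_{m,n=0}^{\infty}\frac{(\gamma_1)_{\alpha_1 m+\beta_1 n}(\gamma_2)_{\alpha_2 m}(\gamma_3)_{\beta_2 n}}{\Gamma(\delta_1+\alpha_3 m+\beta_3 n)}\frac{x^m}{\Gamma(\delta_2+\alpha_4 m)}\frac{y^n}{\Gamma(\delta_3+\beta_4 n)}.$$ The functions are considered at arguments in the region of absolute convergence of their defining series. *)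

(* Defs.v *)
From mathcomp Require Import all_boot all_order all_algebra.
From mathcomp Require Import complex.
From mathcomp Require Import all_classical all_reals all_analysis.

Set Implicit Arguments.
Unset Strict Implicit.
Unset Printing Implicit Defensive.

Import Order.TTheory GRing.Theory Num.Theory.
Import numFieldNormedType.Exports.

Local Open Scope classical_set_scope.
Local Open Scope ring_scope.
Local Open Scope complex_scope.

Definition cexp (R : realType) (z : R[i]) : R[i] :=
  (expR (complex.Re z))%:C * (cos (complex.Im z) +i* sin (complex.Im z)).

(* t ^ z for a real base t > 0. *)
Definition cpow (R : realType) (t : R) (z : R[i]) : R[i] :=
  cexp ((ln t)%:C * z).

(* The library integrates real-valued functions only: a complex-valued function
   is integrated componentwise, with respect to Lebesgue measure. *)
Definition cintegrable (R : realType) (D : set R) (f : R -> R[i]) : Prop :=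
  (@lebesgue_measure R).-integrable D (fun t => (complex.Re (f t))%:E) /\
  (@lebesgue_measure R).-integrable D (fun t => (complex.Im (f t))%:E).

Definition cintegral (R : realType) (D : set R) (f : R -> R[i]) : R[i] :=
  Rintegral (@lebesgue_measure R) D (fun t => complex.Re (f t)) +i*
  Rintegral (@lebesgue_measure R) D (fun t => complex.Im (f t)).

(* Euler's integral, meaningful for Re z > 0. *)
Definition Euler_Gamma (R : realType) (z : R[i]) : R[i] :=
  cintegral `]0, +oo[ (fun t : R => cpow t (z - 1) * (expR (- t))%:C).

(* Analytic continuation by Gamma z = Gamma (z + n) / (z (z + 1) ... (z + n - 1)),
   with n = 0 if Re z > 0 and otherwise the least n with Re (z + n) > 0.
   At the poles 0, -1, -2, ... the product vanishes and 0^-1 = 0, so that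
   Gamma z = 0 there; hence (Gamma z)^-1 is the entire function 1 / Gamma
   at every z, with value 0 at the poles. *)
Definition Gamma (R : realType) (z : R[i]) : R[i] :=
  let n := if 0 < complex.Re z then 0%N else (Num.truncn (- complex.Re z)).+1 in
  Euler_Gamma (z + n%:R) / \prod_(k < n) (z + k%:R).

Definition Gamma_pole (R : realType) (z : R[i]) : Prop :=
  exists k : nat, z = - k%:R.

(* The symbol (g)_l = Gamma (g + l) / Gamma g.  If g is a pole of Gamma, the
   quotient is read as its limit at g, so that for instance (- k)_l is the usual
   (- k) (- k + 1) ... (- k + l - 1) when l is an integer. *)
Definition poch (R : realType) (g : R[i]) (l : R) : R[i] :=
  if `[< Gamma_pole g >]
  then lim ((fun z : R[i]^o => Gamma (z + l%:C) / Gamma z : R[i]^o)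
              @ (g : R[i]^o)^')
  else Gamma (g + l%:C) / Gamma g.

Definition D1_term (R : realType)
    (g1 : R[i]) (a1 b1 : R) (g2 : R[i]) (a2 : R) (g3 : R[i]) (b2 : R)
    (d1 : R[i]) (a3 b3 : R) (d2 : R[i]) (a4 : R) (d3 : R[i]) (b4 : R)
    (x y : R[i]) (m n : nat) : R[i] :=
  poch g1 (a1 * m%:R + b1 * n%:R) * poch g2 (a2 * m%:R) * poch g3 (b2 * n%:R)
    / Gamma (d1 + (a3 * m%:R + b3 * n%:R)%:C)
  * (x ^+ m / Gamma (d2 + (a4 * m%:R)%:C))
  * (y ^+ n / Gamma (d3 + (b4 * n%:R)%:C)).

Definition D1_abs_cvg (R : realType)
    (g1 : R[i]) (a1 b1 : R) (g2 : R[i]) (a2 : R) (g3 : R[i]) (b2 : R)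
    (d1 : R[i]) (a3 b3 : R) (d2 : R[i]) (a4 : R) (d3 : R[i]) (b4 : R)
    (x y : R[i]) : Prop :=
  summable [set: nat * nat] (fun p : nat * nat => (Normc.normc
    (D1_term g1 a1 b1 g2 a2 g3 b2 d1 a3 b3 d2 a4 d3 b4 x y p.1 p.2))%:E).

(* Iterated sum; any other order of summation gives the same value when the
   double series converges absolutely.  R[i]^o carries the topology of the
   complex modulus. *)
Definition D1 (R : realType)
    (g1 : R[i]) (a1 b1 : R) (g2 : R[i]) (a2 : R) (g3 : R[i]) (b2 : R)
    (d1 : R[i]) (a3 b3 : R) (d2 : R[i]) (a4 : R) (d3 : R[i]) (b4 : R)
    (x y : R[i]) : R[i] :=
  let row_sum (m : nat) : R[i]^o := limn (series (fun n : nat =>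
    D1_term g1 a1 b1 g2 a2 g3 b2 d1 a3 b3 d2 a4 d3 b4 x y m n : R[i]^o)) in
  limn (series row_sum).

(* Main.v *)
Require Import Defs.
From mathcomp Require Import all_boot all_order all_algebra.
From mathcomp Require Import complex.
From mathcomp Require Import all_classical all_reals all_analysis.
From mathcomp Require Import measurable_realfun.
From mathcomp Require Import ring lra.

Set Implicit Arguments.
Unset Strict Implicit.
Unset Printing Implicit Defensive.

Import Order.TTheory GRing.Theory Num.Theory.
Import numFieldNormedType.Exports.
Local Open Scope classical_set_scope.
Local Open Scope ring_scope.
Local Open Scope complex_scope.

(** The [(m, n)] term of the series depends on [g3] only through the symbol
    [(g3)_(b2 n)]. Euler's beta integral
    [Gamma p * Gamma q = Gamma (p + q) * int_0^1 t^(p-1) (1-t)^(q-1) dt]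
    ([Gamma_Beta]), taken at [p = g3 + b2 n] and [q = mu - g3], says
    that integrating the term of [mu] against the weight
    [t^(g3-1) (1-t)^(mu-g3-1)], with [y] replaced by [y t^b2], gives the
    term of [g3] up to the constant [Gamma g3 * Gamma q / Gamma mu]. It
    remains to see that this constant is not 0 and to integrate termwise.

    Termwise integration ([cintegral_csum2]) needs the sum of the integrals of the
    moduli, in which the beta integral has the real parts of [p] and [q] as
    parameters, whereas the absolute convergence of the series of [g3]
    controls the moduli of the complex beta integrals. The two are comparable
    uniformly in [n] ([absBeta_le]) because [|Gamma (s + i tau)|] is at least a
    constant times [Gamma s] when [tau] is fixed and [s] is bounded away from 0
    ([Euler_Gamma_lower]). For [s] large this holds because the measure
    [t^(s-1) exp (- t) dt] concentrates near [t = s], where [t^(i tau)] hardly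
    varies; the functional equation extends the bound to smaller [s]. The same
    bound shows that Gamma has no zero in the right half-plane, hence that the
    constant above is not 0. *)

Local Notation Re := complex.Re.
Local Notation Im := complex.Im.
Local Notation normc := Normc.normc.

(** * Complex numbers in components *)

Section Components.
Variable R : realType.
Implicit Types (z w : R[i]) (c t s : R).

Lemma complex_ext z w : Re z = Re w -> Im z = Im w -> z = w.
Proof. by case: z w => [a b] [c d] /= -> ->. Qed.

Lemma ReD z w : Re (z + w) = Re z + Re w. Proof. by case: z w => ? ? []. Qed.
Lemma ImD z w : Im (z + w) = Im z + Im w. Proof. by case: z w => ? ? []. Qed.
Lemma ReN z : Re (- z) = - Re z. Proof. by case: z. Qed.
Lemma ImN z : Im (- z) = - Im z. Proof. by case: z. Qed.
Lemma ReM z w : Re (z * w) = Re z * Re w - Im z * Im w.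
Proof. by case: z w => ? ? []. Qed.
Lemma ImM z w : Im (z * w) = Re z * Im w + Im z * Re w.
Proof. by case: z w => ? ? []. Qed.
Lemma ReMr c z : Re (c%:C * z) = c * Re z.
Proof. by rewrite ReM /= mul0r subr0. Qed.
Lemma ImMr c z : Im (c%:C * z) = c * Im z.
Proof. by rewrite ImM /= mul0r addr0. Qed.

Definition compE := (ReD, ImD, ReN, ImN, ReM, ImM).

Lemma Re_nat n : Re (n%:R : R[i]) = n%:R.
Proof. by rewrite -(rmorph_nat (real_complex R)). Qed.

Lemma normc_ge0 z : 0 <= normc z.
Proof. by case: z => a b; exact: sqrtr_ge0. Qed.

Lemma normc_real c : normc c%:C = `|c|.
Proof. by rewrite /= expr0n addr0 sqrtr_sqr. Qed.

Lemma normrRe z : `|Re z| <= normc z.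
Proof.
case: z => a b /=; rewrite -(sqrtr_sqr a) ler_wsqrtr// lerDl; exact: sqr_ge0.
Qed.

Lemma normrIm z : `|Im z| <= normc z.
Proof.
case: z => a b /=; rewrite -(sqrtr_sqr b) ler_wsqrtr// lerDr; exact: sqr_ge0.
Qed.

Lemma normc_le z : normc z <= `|Re z| + `|Im z|.
Proof.
case: z => a b /=; rewrite -[leRHS]ger0_norm ?addr_ge0//.
rewrite -sqrtr_sqr ler_wsqrtr// sqrrD !real_normK ?num_real//.
by rewrite addrAC lerDl mulrn_wge0// mulr_ge0.
Qed.

(** * Complex powers of positive reals *)

Lemma cpowE t z :
  cpow t z = (expR (Re z * ln t))%:C * (cos (Im z * ln t) +i* sin (Im z * ln t)).
Proof. by rewrite /cpow /cexp ReMr ImMr (mulrC (ln t)) (mulrC (ln t)). Qed.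

Lemma Re_cpow t z : Re (cpow t z) = expR (Re z * ln t) * cos (Im z * ln t).
Proof. by rewrite cpowE ReMr. Qed.

Lemma Im_cpow t z : Im (cpow t z) = expR (Re z * ln t) * sin (Im z * ln t).
Proof. by rewrite cpowE ImMr. Qed.

(** The rules for powers come first: a power is a product by definition, and
    the rules for products would unfold it. *)
Definition cpow_compE := (Re_cpow, Im_cpow, compE).

Lemma normc_cpow t z : normc (cpow t z) = expR (Re z * ln t).
Proof.
rewrite cpowE Normc.normcM normc_real ger0_norm ?expR_ge0//=.
by rewrite cos2Dsin2 sqrtr1 mulr1.
Qed.

Lemma cpow_real t s : cpow t s%:C = (expR (s * ln t))%:C.
Proof.
apply: complex_ext; first by rewrite [LHS]Re_cpow /= mul0r cos0 mulr1.
by rewrite [LHS]Im_cpow /= mul0r sin0 mulr0.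
Qed.

Lemma cpowD t z w : cpow t (z + w) = cpow t z * cpow t w.
Proof.
apply: complex_ext; rewrite !cpow_compE !mulrDl expRD.
  by rewrite cosD; ring.
by rewrite sinD; ring.
Qed.

Lemma cpow0 t : cpow t 0 = 1.
Proof. by rewrite -[0]/(0%:C) cpow_real mul0r expR0. Qed.

Lemma cpow1 z : cpow 1 z = 1.
Proof. by rewrite cpowE ln1 !mulr0 expR0 cos0 sin0 mul1r. Qed.

Lemma cpowM t s z : 0 < t -> 0 < s -> cpow (t * s) z = cpow t z * cpow s z.
Proof.
move=> t0 s0; apply: complex_ext;
  rewrite !cpow_compE lnM ?posrE// !mulrDr expRD.
  by rewrite cosD; ring.
by rewrite sinD; ring.
Qed.

Lemma cpow_natr t n : 0 < t -> cpow t n%:R = (t ^+ n)%:C.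
Proof.
move=> t0; rewrite -(rmorph_nat (real_complex R)) cpow_real.
by rewrite mulr_natl -lnXn// lnK// posrE exprn_gt0.
Qed.

End Components.

(** * Lebesgue integrals of complex functions *)

Section ComplexIntegral.
Variable R : realType.
Local Notation mu := (@lebesgue_measure R).

Definition cmeasurable d (T : measurableType d) (D : set T) (f : T -> R[i]) :=
  measurable_fun D (fun t => Re (f t)) /\ measurable_fun D (fun t => Im (f t)).

Lemma cmeasurableM d (T : measurableType d) (D : set T) (f g : T -> R[i]) :
  cmeasurable D f -> cmeasurable D g -> cmeasurable D (fun t => f t * g t).
Proof.
move=> [f1 f2] [g1 g2]; split.
  under eq_fun do rewrite ReM.
  by apply: measurable_funB; exact: measurable_funM.
under eq_fun do rewrite ImM.
by apply: measurable_funD; exact: measurable_funM.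
Qed.

Lemma cmeasurable_cst d (T : measurableType d) (D : set T) (c : R[i]) :
  cmeasurable D (fun=> c).
Proof. by split; exact: measurable_cst. Qed.

Lemma cmeasurable_cpow d (T : measurableType d) (D : set T) (f : T -> R) z :
  measurable_fun D f -> cmeasurable D (fun t => cpow (f t) z).
Proof.
move=> mf.
have mln (c : R) : measurable_fun D (fun t => c * ln (f t)).
  by apply: measurable_funM => //; apply: measurableT_comp mf; exact: measurable_ln.
have mexp : measurable_fun D (fun t => expR (Re z * ln (f t))).
  by apply: measurableT_comp (mln _); exact: measurable_expR.
split.
  under eq_fun do rewrite Re_cpow.
  apply: measurable_funM => //; apply: measurableT_comp (mln _).
  by apply: continuous_measurable_fun; exact: continuous_cos.
under eq_fun do rewrite Im_cpow.
apply: measurable_funM => //; apply: measurableT_comp (mln _).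
by apply: continuous_measurable_fun; exact: continuous_sin.
Qed.

Lemma cmeasurable_real d (T : measurableType d) (D : set T) (f : T -> R) :
  measurable_fun D f -> cmeasurable D (fun t => (f t)%:C).
Proof. by move=> mf; split => //=; exact: measurable_cst. Qed.

Lemma cmeasurable_if d (T : measurableType d) (D : set T) (b : T -> bool)
    (f g : T -> R[i]) : measurable D -> measurable_fun D b ->
  cmeasurable D f -> cmeasurable D g ->
  cmeasurable D (fun t => if b t then f t else g t).
Proof.
move=> mD mb [f1 f2] [g1 g2]; split.
  rewrite (_ : (fun t => Re _) =
      fun t => if b t then Re (f t) else Re (g t)); last first.
    by apply/funext => t; case: ifP.
  by apply: measurable_fun_if => //;
    apply: measurable_funS mD _ _ => //; exact: subIsetl.
rewrite (_ : (fun t => Im _) =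
    fun t => if b t then Im (f t) else Im (g t)); last first.
  by apply/funext => t; case: ifP.
by apply: measurable_fun_if => //;
  apply: measurable_funS mD _ _ => //; exact: subIsetl.
Qed.

Lemma cmeasurable_comp d d' (T : measurableType d) (U : measurableType d')
    (f : U -> R[i]) (h : T -> U) : measurable_fun setT h ->
  cmeasurable setT f -> cmeasurable setT (f \o h).
Proof.
move=> mh [f1 f2]; split.
  exact: (@measurableT_comp _ _ _ _ _ _ (fun t => Re (f t)) _ h).
exact: (@measurableT_comp _ _ _ _ _ _ (fun t => Im (f t)) _ h).
Qed.

Lemma cintegrable_le (D : set R) (f : R -> R[i]) (g : R -> R) : measurable D ->
  cmeasurable D f -> mu.-integrable D (EFin \o g) ->
  (forall t, D t -> normc (f t) <= g t) -> cintegrable D f.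
Proof.
move=> mD [f1 f2] ig fg; split; apply: le_integrable ig => //;
  try exact/measurable_EFinP; move=> t Dt /=; rewrite lee_fin.
- exact: le_trans (le_trans (normrRe _) (fg _ Dt)) (ler_norm _).
- exact: le_trans (le_trans (normrIm _) (fg _ Dt)) (ler_norm _).
Qed.

Lemma rintegrableZ (D : set R) (k : R) (g : R -> R) : measurable D ->
  mu.-integrable D (fun t => (g t)%:E) ->
  mu.-integrable D (EFin \o (fun t => k * g t)).
Proof.
move=> mD gi.
rewrite (_ : EFin \o _ = fun t => k%:E * (g t)%:E)%E; last exact/funext.
exact: integrableZl.
Qed.

Lemma cintegrableZ (D : set R) (c : R[i]) (f : R -> R[i]) : measurable D ->
  cintegrable D f -> cintegrable D (fun t => c * f t).
Proof.
move=> mD [f1 f2]; split.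
  under eq_fun do rewrite ReM EFinB EFinM EFinM.
  by apply: integrableB => //; exact: integrableZl.
under eq_fun do rewrite ImM EFinD EFinM EFinM.
by apply: integrableD => //; exact: integrableZl.
Qed.

Lemma cintegralZ (D : set R) (c : R[i]) (f : R -> R[i]) : measurable D ->
  cintegrable D f -> cintegral D (fun t => c * f t) = c * cintegral D f.
Proof.
move=> mD [f1 f2]; apply: complex_ext => /=.
  under eq_Rintegral do rewrite ReM.
  rewrite RintegralB//; last 2 first.
  - exact: (rintegrableZ (Re c) mD f1).
  - exact: (rintegrableZ (Im c) mD f2).
  by rewrite !RintegralZl// ReM.
under eq_Rintegral do rewrite ImM.
rewrite RintegralD//; last 2 first.
- exact: (rintegrableZ (Re c) mD f2).
- exact: (rintegrableZ (Im c) mD f1).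
by rewrite !RintegralZl// ImM.
Qed.

Lemma eq_cintegral (D : set R) (f g : R -> R[i]) :
  (forall t, D t -> f t = g t) -> cintegral D f = cintegral D g.
Proof.
by move=> fg; congr (_ +i* _); apply: eq_Rintegral => t /set_mem Dt; rewrite fg.
Qed.

Lemma eq_cintegrable (D : set R) (f g : R -> R[i]) : measurable D ->
  (forall t, D t -> f t = g t) -> cintegrable D f -> cintegrable D g.
Proof.
move=> mD fg [f1 f2]; split.
  by apply: eq_integrable f1 => // t /set_mem Dt; rewrite fg.
by apply: eq_integrable f2 => // t /set_mem Dt; rewrite fg.
Qed.

Lemma cintegral_mkcond (D : set R) (f : R -> R[i]) :
  cintegral D f = cintegral setT (fun t => if t \in D then f t else 0).
Proof.
congr (_ +i* _); rewrite Rintegral_mkcond; apply: eq_Rintegral => t _;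
  by rewrite patchE; case: ifP.
Qed.

(** Lebesgue measure is the only measure giving each interval ]a, b] the mass
    [b - a], and so does [u] times its image under [t |-> u * t + c]. *)
Lemma ge0_integral_affine (u c : R) (f : R -> \bar R) : 0 < u ->
  measurable_fun setT f -> (forall t, 0 <= f t)%E ->
  (\int[mu]_t f t = u%:E * \int[mu]_t f (u * t + c)%R)%E.
Proof.
move=> u0 mf f0.
have mphi : @measurable_fun _ _ (measurableTypeR R) (measurableTypeR R) setT
    (fun t : R => u * t + c).
  by apply: measurable_funD => //; exact: measurable_funM.
pose pm : {measure set (measurableTypeR R) -> \bar R} :=
  measure_function_pushforward__canonical__measure_function_Measure mu mphi.
pose nu : {measure set (measurableTypeR R) -> \bar R} :=
  mscale (NngNum (ltW u0)) pm.
have munu X : measurable X -> mu X = nu X.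
  apply: lebesgue_measure_unique => Y /ocitvP[->|[[a b]/= ab ->]].
    by rewrite measure0 /nu measure0.
  rewrite (_ : nu _ = (u%:E * mu ((fun t : R => (u * t + c)%R) @^-1` `]a, b]))%E)//.
  rewrite lebesgue_measure_itv /=.
  rewrite (_ : _ @^-1` _ = `](a - c) / u, (b - c) / u]%classic); last first.
    apply/seteqP; split => t /=; rewrite !in_itv/= ltr_pdivrMr// ler_pdivlMr//;
      by rewrite ltrBlDr lerBrDr (mulrC t).
  rewrite lebesgue_measure_itv/= !lte_fin ab ltr_pM2r ?invr_gt0// ltrD2r ab.
  rewrite -!EFinB -EFinM; congr (_%:E).
  by field; rewrite gt_eqF.
rewrite (eq_measure_integral nu); last by move=> A mA _; exact: munu.
rewrite ge0_integral_mscale//; congr (_ * _)%E.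
by rewrite ge0_integral_pushforward.
Qed.

Lemma integral_affine (u c : R) (f : R -> \bar R) : 0 < u ->
  mu.-integrable setT f ->
  (\int[mu]_t f t = u%:E * \int[mu]_t f (u * t + c)%R)%E.
Proof.
move=> u0 fi; have mf := measurable_int _ fi.
have ifp := integrable_pos_fin_num measurableT fi.
have ifn := integrable_neg_fin_num measurableT fi.
have pE := @ge0_integral_affine u c _ u0 (measurable_funepos mf) (funepos_ge0 f).
have nE := @ge0_integral_affine u c _ u0 (measurable_funeneg mf) (funeneg_ge0 f).
rewrite pE in ifp; rewrite nE in ifn.
have u0' : (u^-1%:E * u%:E = 1 :> \bar R)%E by rewrite -EFinM mulVf// gt_eqF.
have inn : (\int[mu]_t f^\- (u * t + c)%R)%E \is a fin_num.
  by have := fin_numM (isT : u^-1%:E \is a fin_num) ifn; rewrite muleA u0' mul1e.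
rewrite integralE pE nE -muleBr//; last first.
  by apply: fin_num_adde_defl; rewrite fin_numN.
congr (_ * _)%E; rewrite [RHS]integralE.
by rewrite (funepos_comp f (fun t => u * t + c)) (funeneg_comp f (fun t => u * t + c)).
Qed.

Lemma integrable_affine (u c : R) (f : R -> \bar R) : 0 < u ->
  mu.-integrable setT f -> mu.-integrable setT (fun t => f (u * t + c)).
Proof.
move=> u0 /integrableP[mf fi]; apply/integrableP; split.
  apply: (@measurableT_comp _ _ _ _ _ _ f _ (fun t : R => u * t + c)) => //.
  by apply: measurable_funD => //; exact: measurable_funM.
move: fi; rewrite (@ge0_integral_affine u c (fun t => `|f t|)%E u0)//; last first.
  exact: measurableT_comp.
by rewrite !ltey; apply: contra => /eqP ->; rewrite gt0_muley// lte_fin.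
Qed.

Lemma cintegrable_affine (u c : R) (f : R -> R[i]) : 0 < u ->
  cintegrable setT f -> cintegrable setT (fun t => f (u * t + c)).
Proof.
by move=> u0 [f1 f2]; split;
  [exact: (integrable_affine c u0 f1)|exact: (integrable_affine c u0 f2)].
Qed.

Lemma cintegral_affine (u c : R) (f : R -> R[i]) : 0 < u -> cintegrable setT f ->
  cintegral setT f = u%:C * cintegral setT (fun t => f (u * t + c)).
Proof.
move=> u0 [f1 f2]; apply: complex_ext; rewrite ?(ReMr, ImMr) /= /Rintegral.
  rewrite (integral_affine c u0 f1) fineM//.
  exact: integrable_fin_num (integrable_affine c u0 f1).
rewrite (integral_affine c u0 f2) fineM//.
exact: integrable_fin_num (integrable_affine c u0 f2).
Qed.

(** * Limits of sequences of complex functions *)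

Lemma rdominated_cvg (D : set R) (f_ : nat -> R -> R) (f g : R -> R) :
  measurable D -> (forall n, measurable_fun D (f_ n)) ->
  (forall t, D t -> f_ ^~ t @ \oo --> f t) -> mu.-integrable D (EFin \o g) ->
  (forall n t, D t -> `|f_ n t| <= g t) ->
  mu.-integrable D (EFin \o f) /\
  (fun n => Rintegral mu D (f_ n)) @ \oo --> Rintegral mu D f.
Proof.
move=> mD mf_ ff ig fg.
have mf : measurable_fun D f by exact: measurable_fun_cvg mf_ ff.
have [|||||fi _ cv] := @dominated_convergence _ _ _ mu D mD
    (fun n => EFin \o f_ n) (EFin \o f) (EFin \o g).
- by move=> n; apply/measurable_EFinP; exact: mf_.
- exact/measurable_EFinP.
- apply/aeW => t Dt; apply: cvg_EFin; first exact: nearW.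
  exact: ff.
- by [].
- by apply/aeW => t n Dt /=; rewrite lee_fin; exact: fg.
have ifin : (\int[mu]_(t in D) (f t)%:E)%E \is a fin_num.
  by apply: integrable_fin_num fi; exact: mD.
by split=> //; apply: fine_cvg; rewrite /Rintegral fineK.
Qed.

(** Convergence of the components, the form in which real theorems on limits of
    integrals apply; [ccvg_cvg] below relates it to the topology of the modulus. *)
Definition ccvg (u : nat -> R[i]) (l : R[i]) :=
  (fun n => Re (u n)) @ \oo --> Re l /\ (fun n => Im (u n)) @ \oo --> Im l.

Lemma cdominated_cvg (D : set R) (f_ : nat -> R -> R[i]) (f : R -> R[i])
    (g : R -> R) :
  measurable D -> (forall n, cmeasurable D (f_ n)) ->
  (forall t, D t -> ccvg (f_ ^~ t) (f t)) -> mu.-integrable D (EFin \o g) ->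
  (forall n t, D t -> normc (f_ n t) <= g t) ->
  cintegrable D f /\ ccvg (fun n => cintegral D (f_ n)) (cintegral D f).
Proof.
move=> mD mf_ ff ig fg.
have [i1 c1] := @rdominated_cvg D (fun n t => Re (f_ n t)) (fun t => Re (f t)) g mD
  (fun n => (mf_ n).1) (fun t Dt => (ff t Dt).1) ig
  (fun n t Dt => le_trans (normrRe _) (fg n t Dt)).
have [i2 c2] := @rdominated_cvg D (fun n t => Im (f_ n t)) (fun t => Im (f t)) g mD
  (fun n => (mf_ n).2) (fun t Dt => (ff t Dt).2) ig
  (fun n t Dt => le_trans (normrIm _) (fg n t Dt)).
by split.
Qed.

End ComplexIntegral.

(** * The integral of a complex power over the unit interval *)

Section PowerIntegral.
Variable R : realType.
Local Notation mu := (@lebesgue_measure R).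

Lemma is_derive_cpow (t : R) (z : R[i]) : 0 < t ->
  is_derive t 1 (fun s => Re (cpow s z)) (Re (z * cpow t (z - 1))) /\
  is_derive t 1 (fun s => Im (cpow s z)) (Im (z * cpow t (z - 1))).
Proof.
move=> t0.
have dln := is_derive1_ln t0.
have dl (c : R) : is_derive t 1 (fun s => c * ln s) (c * t^-1).
  exact: is_deriveZ.
have de : is_derive t 1 (fun s => expR (Re z * ln s))
    (expR (Re z * ln t) * (Re z * t^-1)).
  exact: is_derive1_comp.
have dc : is_derive t 1 (fun s => cos (Im z * ln s))
    (- sin (Im z * ln t) * (Im z * t^-1)).
  exact: is_derive1_comp.
have ds : is_derive t 1 (fun s => sin (Im z * ln s))
    (cos (Im z * ln t) * (Im z * t^-1)).
  exact: is_derive1_comp.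
have e1 : expR ((Re z - 1) * ln t) = expR (Re z * ln t) * t^-1.
  by rewrite mulrBl mul1r expRB lnK.
split.
  under eq_fun do rewrite Re_cpow.
  apply: (is_derive_eq (is_deriveM de dc)).
  rewrite /GRing.scale /= ReM Re_cpow Im_cpow !compE /= oppr0 addr0 e1.
  by ring.
under eq_fun do rewrite Im_cpow.
apply: (is_derive_eq (is_deriveM de ds)).
rewrite /GRing.scale /= ImM Re_cpow Im_cpow !compE /= oppr0 addr0 e1.
by ring.
Qed.

Lemma continuous_cpow (t : R) (z : R[i]) : 0 < t ->
  {for t, continuous (fun s => Re (cpow s z))} /\
  {for t, continuous (fun s => Im (cpow s z))}.
Proof.
move=> t0; have [d1 d2] := is_derive_cpow z t0.
by split; apply: differentiable_continuous; apply/derivable1_diffP; exact: ex_derive.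
Qed.

Lemma FTC2_pos (f F : R -> R) (e : R) : 0 < e < 1 ->
  (forall t : R, 0 < t -> {for t, continuous f}) ->
  (forall t : R, 0 < t -> is_derive t 1 F (f t)) ->
  mu.-integrable `[e, 1] (EFin \o f) /\
  Rintegral mu `[e, 1] f = F 1 - F e.
Proof.
move=> /andP[e0 e1] cf dF.
have cwf : {within `[e, 1], continuous f}.
  apply: continuous_in_subspaceT => t /set_mem/=; rewrite in_itv/= => /andP[et _].
  by apply: cf; exact: lt_le_trans et.
have cF (t : R) : 0 < t -> {for t, continuous F}.
  move=> t0; apply: differentiable_continuous; apply/derivable1_diffP.
  by have dFt := dF t t0; exact: ex_derive.
split; first exact: (continuous_compact_integrable (@segment_compact _ _ _) cwf).
rewrite /Rintegral (@continuous_FTC2 R f F e 1 e1 cwf)//.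
  split.
  - move=> t; rewrite in_itv/= => /andP[et _].
    by have dFt := dF t (lt_trans e0 et); exact: ex_derive.
  - by apply: cvg_at_right_filter; exact: cF.
  - by apply: cvg_at_left_filter; exact: cF.
move=> t; rewrite in_itv/= => /andP[et _].
by rewrite derive1E; have dFt := dF t (lt_trans e0 et); exact: derive_val.
Qed.

Lemma cintegral_cpow_cut (e : R) (z : R[i]) : 0 < e < 1 ->
  z * cintegral `[e, 1] (fun t => cpow t (z - 1)) = 1 - cpow e z.
Proof.
move=> e01.
have cint : cintegrable `[e, 1] (fun t => cpow t (z - 1)).
  have [e0 _] := andP e01.
  split; (apply: continuous_compact_integrable; first exact: segment_compact);
    apply: continuous_in_subspaceT => t /set_mem/=; rewrite in_itv/= => /andP[et _];
    [apply: (continuous_cpow (z - 1) _).1|apply: (continuous_cpow (z - 1) _).2];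
    exact: lt_le_trans et.
rewrite -cintegralZ//.
have cz (t : R) : 0 < t -> {for t, continuous (fun s => Re (z * cpow s (z - 1)))} /\
    {for t, continuous (fun s => Im (z * cpow s (z - 1)))}.
  move=> t0; have [c1 c2] := continuous_cpow (z - 1) t0; split.
    rewrite (_ : (fun s => _) = fun s => Re z * Re (cpow s (z - 1))
      - Im z * Im (cpow s (z - 1))); last by apply/funext => s; rewrite ReM.
    by apply: cvgB; apply: cvgM => //; exact: cvg_cst.
  rewrite (_ : (fun s => _) = fun s => Re z * Im (cpow s (z - 1))
      + Im z * Re (cpow s (z - 1))); last by apply/funext => s; rewrite ImM.
  by apply: cvgD; apply: cvgM => //; exact: cvg_cst.
apply: complex_ext; [rewrite ReD ReN|rewrite ImD ImN] => /=.
  have [_ ->] := FTC2_pos e01 (fun t t0 => (cz t t0).1)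
    (fun t t0 => (is_derive_cpow z t0).1).
  by rewrite cpow1.
have [_ ->] := FTC2_pos e01 (fun t t0 => (cz t t0).2)
    (fun t t0 => (is_derive_cpow z t0).2).
by rewrite cpow1.
Qed.

Let eps (n : nat) : R := expR (- n.+1%:R).

Let eps01 n : 0 < eps n < 1.
Proof. by rewrite expR_gt0 expR_lt1 oppr_lt0 ltr0Sn. Qed.

Let cut n := [set t : R | t \in `[eps n, 1] ].

Let ln_eps n : ln (eps n) = - n.+1%:R. Proof. by rewrite expRK. Qed.

Let eps_small (t : R) : 0 < t -> \forall n \near \oo, eps n <= t.
Proof.
move=> t0; near=> n.
rewrite -(@lnK _ t)// ler_expR lerNl.
apply: (@le_trans _ _ n%:R); last by rewrite ler_nat.
near: n; exact: nbhs_infty_ger.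
Unshelve. end_near. Qed.

Lemma measurable_powexp (s : R) (D : set R) :
  measurable_fun D (fun t => expR (s * ln t)).
Proof.
apply: measurable_funTS; apply: measurableT_comp; first exact: measurable_expR.
by apply: measurable_funM => //; exact: measurable_ln.
Qed.

(** The primitive [t ^ s] of [s * t ^ (s - 1)] has its values between 0 and 1, so
    the integrals over the intervals [eps n, 1] are bounded; they increase to the
    integral over ]0, 1]. *)
Lemma integrable_power (s : R) : 0 < s ->
  mu.-integrable `]0, 1] (fun t => (expR ((s - 1) * ln t))%:E).
Proof.
move=> s0.
pose f t := Re (s%:C * cpow t (s%:C - 1)).
have fE t : f t = s * expR ((s - 1) * ln t).
  rewrite /f (_ : s%:C - 1 = (s - 1)%:C); last by rewrite rmorphB.
  by rewrite cpow_real ReMr.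
have f0 t : 0 <= f t by rewrite fE mulr_ge0 ?expR_ge0 ?(ltW s0).
have mf D : measurable_fun D (EFin \o f).
  apply/measurable_EFinP; rewrite (_ : f = fun t => s * expR ((s - 1) * ln t)).
    by apply: measurable_funM => //; exact: measurable_powexp.
  exact/funext.
have -> : (fun t => (expR ((s - 1) * ln t))%:E) = (fun t => s^-1%:E * (f t)%:E)%E.
  by apply/funext => t; rewrite fE -EFinM mulrA mulVf ?gt_eqF// mul1r.
apply: integrableZl => //; apply/integrableP; split; first exact: mf.
under eq_integral do rewrite gee0_abs ?lee_fin//.
rewrite (_ : `]0, 1]%classic = \bigcup_n cut n); last first.
  apply/seteqP; split => t /=.
    rewrite in_itv/= => /andP[t0 t1]; have [n _ /(_ n (leqnn n)) /= nt] := eps_small t0.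
    by exists n => //=; rewrite /cut/= in_itv/= nt.
  move=> [n _ /=]; rewrite /cut /= !in_itv/= => /andP[nt t1]; rewrite t1 andbT.
  by apply: lt_le_trans nt; have /andP[] := eps01 n.
have cf (t : R) : 0 < t -> {for t, continuous f}.
  move=> t0; rewrite (_ : f = fun t => s * Re (cpow t (s%:C - 1))); last first.
    by apply/funext => u; rewrite /f ReMr.
  by apply: cvgM; [exact: cvg_cst|exact: (continuous_cpow _ t0).1].
have le n : (\int[mu]_(t in cut n) (f t)%:E <= 1)%E.
  have [fi fv] := @FTC2_pos f (fun t => Re (cpow t s%:C)) _ (eps01 n)
    cf (fun t t0 => (is_derive_cpow s%:C t0).1).
  have := congr1 EFin fv; rewrite /Rintegral fineK ?integrable_fin_num// => ->.
  by rewrite cpow1 lee_fin gerBl Re_cpow /= mul0r cos0 mulr1 expR_ge0.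
apply: (@le_lt_trans _ _ 1%E); last exact: ltry.
have cvint : (fun n => \int[mu]_(t in cut n) (f t)%:E)%E @ \oo -->
    (\int[mu]_(t in \bigcup_n cut n) (f t)%:E)%E.
  apply: (@ge0_nondecreasing_set_cvg_integral _ (measurableTypeR R) R cut
    (EFin \o f) mu).
  - move=> m n mn; apply/subsetPset => t /=.
    rewrite /cut /= !in_itv/= => /andP[mt ->].
    by rewrite andbT (le_trans _ mt)// ler_expR lerN2 ler_nat.
  - by move=> n; exact: measurable_itv.
  - by move=> n; exact: mf.
  - by move=> n t _; rewrite lee_fin.
exact: (cvge_to_le cvint (nearW _ le)).
Qed.

Lemma cvg_cpow_eps (z : R[i]) : 0 < Re z -> ccvg (fun n => cpow (eps n) z) 0.
Proof.
move=> z0.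
have c0 : (fun n => expR (Re z * ln (eps n))) @ \oo --> (0 : R).
  under eq_fun do rewrite ln_eps mulrN -mulNr expRM_natr.
  have : (fun n => expR (- Re z) ^+ n) @ \oo --> (0 : R).
    by apply: cvg_expr; rewrite ger0_norm ?expR_ge0// expR_lt1 oppr_lt0.
  by rewrite -cvg_shiftS.
split; (apply/cvgrPdist_le => e e_gt0;
  move/cvgrPdist_le: c0 => /(_ e e_gt0); apply: filterS => n;
  rewrite !sub0r !normrN [in leLHS]ger0_norm ?expR_ge0// -normc_cpow; apply: le_trans).
- exact: normrRe.
- exact: normrIm.
Qed.

Lemma cmeasurable_power (z : R[i]) D : cmeasurable D (fun t : R => cpow t z).
Proof. exact: cmeasurable_cpow. Qed.

Lemma cintegrable_power (z : R[i]) : 0 < Re z ->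
  cintegrable `]0, 1] (fun t => cpow t (z - 1)).
Proof.
move=> z0; apply: (cintegrable_le _ _ (integrable_power z0)) => //.
  exact: cmeasurable_power.
by move=> t _; rewrite normc_cpow ReD ReN.
Qed.

(** The integrals over [eps n, 1] are [(1 - eps n ^ z) / z], and [eps n ^ z]
    tends to 0. *)
Lemma cintegral_power (z : R[i]) : 0 < Re z ->
  cintegral `]0, 1] (fun t => cpow t (z - 1)) = z^-1.
Proof.
move=> z0.
have zn0 : z != 0 by apply: contraTneq z0 => ->; rewrite ltxx.
pose f_ n (t : R) := if eps n <= t then cpow t (z - 1) else 0.
have fE n : cintegral `]0, 1] (f_ n) = z^-1 * (1 - cpow (eps n) z).
  rewrite -(cintegral_cpow_cut z (eps01 n)) mulrA mulVf// mul1r.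
  rewrite cintegral_mkcond [RHS]cintegral_mkcond; apply: eq_cintegral => t _.
  rewrite /f_ !mem_setE !in_itv/=.
  have [nt|] := leP (eps n) t; last by case: ifP.
  by rewrite (lt_le_trans _ nt)//; have /andP[] := eps01 n.
have [|||||_] := @cdominated_cvg R `]0, 1] f_ (fun t => cpow t (z - 1))
  (fun t => expR ((Re z - 1) * ln t)).
- by [].
- move=> n; apply: cmeasurable_if; [by []|exact: measurable_fun_ler| |].
    exact: cmeasurable_power.
  exact: cmeasurable_cst.
- move=> t; rewrite /= in_itv/= => /andP[t0 _].
  by split; apply: cvg_near_cst; apply: filterS (eps_small t0) => n nt; rewrite /f_ nt.
- exact: integrable_power.
- move=> n t _; rewrite /f_; case: ifP => _; last by rewrite Normc.normc0 expR_ge0.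
  by rewrite normc_cpow ReD ReN.
move=> [cR cI].
have [eR eI] := cvg_cpow_eps z0.
have c1 : (fun n => 1 - Re (cpow (eps n) z)) @ \oo --> (1 - 0 : R).
  exact: (cvgB (cvg_cst _) eR).
have cV : ccvg (fun n => cintegral `]0, 1] (f_ n)) z^-1.
  split.
    rewrite (_ : (fun n => _) = fun n => Re z^-1 * (1 - Re (cpow (eps n) z))
        + Im z^-1 * Im (cpow (eps n) z)); last first.
      by apply/funext => n; rewrite fE ReM ReD ImD ReN ImN /= sub0r mulrN opprK.
    rewrite -[X in _ --> X](_ : Re z^-1 * (1 - 0) + Im z^-1 * 0 = _).
      exact: (cvgD (cvgM (cvg_cst _) c1) (cvgM (cvg_cst _) eI)).
    by rewrite subr0 mulr1 mulr0 addr0.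
  rewrite (_ : (fun n => _) = fun n => Im z^-1 * (1 - Re (cpow (eps n) z))
        - Re z^-1 * Im (cpow (eps n) z)); last first.
    by apply/funext => n; rewrite fE ImM ReD ImD ReN ImN /= sub0r mulrN addrC.
  rewrite -[X in _ --> X](_ : Im z^-1 * (1 - 0) - Re z^-1 * 0 = _).
    exact: (cvgB (cvgM (cvg_cst _) c1) (cvgM (cvg_cst _) eI)).
  by rewrite subr0 mulr1 mulr0 subr0.
apply: complex_ext.
  exact: (cvg_unique _ cR cV.1).
exact: (cvg_unique _ cI cV.2).
Qed.

End PowerIntegral.

(** * Fubini's theorem for complex functions *)

Section ComplexFubini.
Variable R : realType.
Local Notation mu := (@lebesgue_measure R).

Lemma measurable_normc d (T : measurableType d) (D : set T) (f : T -> R[i]) :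
  cmeasurable D f -> measurable_fun D (fun t => normc (f t)).
Proof.
move=> [f1 f2]; rewrite (_ : (fun t => _) =
    fun t => Num.sqrt (Re (f t) ^+ 2 + Im (f t) ^+ 2)); last first.
  by apply/funext => t; case: (f t).
apply: measurableT_comp.
  by apply: continuous_measurable_fun; exact: sqrt_continuous.
by apply: measurable_funD; exact: measurable_funX.
Qed.

Let fubini_real (h : R * R -> R) (H : R * R -> R) :
  measurable_fun setT h -> measurable_fun setT H ->
  (forall w, `|h w| <= H w) ->
  (\int[mu]_s \int[mu]_u (H (s, u))%:E < +oo)%E ->
  (forall s, mu.-integrable setT (fun u => (h (s, u))%:E)) ->
  (forall u, mu.-integrable setT (fun s => (h (s, u))%:E)) ->
  Rintegral mu setT (fun s => Rintegral mu setT (fun u => h (s, u))) =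
  Rintegral mu setT (fun u => Rintegral mu setT (fun s => h (s, u))).
Proof.
move=> mh mH hH Hoo h1 h2.
have mh' : measurable_fun setT (EFin \o h) by exact/measurable_EFinP.
have mH' : measurable_fun setT (EFin \o H) by exact/measurable_EFinP.
have H0 w : (0 <= (EFin \o H) w)%E by rewrite lee_fin (le_trans _ (hH w)).
have ih : (mu \x mu)%E.-integrable setT (EFin \o h).
  apply: (iffRL (@integrable12ltyP _ _ _ _ R mu mu _ mh')); apply: le_lt_trans Hoo.
  apply: ge0_le_integral => //.
  - by move=> s _; exact: integral_ge0.
  - have ma : measurable_fun setT (abse \o (EFin \o h)) by exact: measurableT_comp.
    exact: (@measurable_fun_fubini_tonelli_F _ _ _ _ R mu _ ma (fun=> abse_ge0 _)).
  - exact: (@measurable_fun_fubini_tonelli_F _ _ _ _ R mu _ mH' H0).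
  - move=> s _; apply: ge0_le_integral => //.
    + apply: measurableT_comp => //; apply: measurableT_comp mh' _.
      exact: measurable_pair1.
    + by apply: measurableT_comp mH' _; exact: measurable_pair1.
    + by move=> u _; rewrite lee_fin; exact: hH.
have F := Fubini ih.
rewrite /Rintegral; congr fine.
transitivity (\int[mu]_s \int[mu]_u (EFin \o h) (s, u))%E.
  by apply: eq_integral => s _; rewrite fineK//; exact: integrable_fin_num (h1 s).
rewrite F; apply: eq_integral => u _; rewrite fineK//.
exact: integrable_fin_num (h2 u).
Qed.

(** Integrability of every section, and not of almost every one, makes the
    integrals of the finite values agree with the extended real ones at each
    point, so that the real theorem applies to each component. *)
Lemma cfubini (H : R * R -> R[i]) : cmeasurable setT H ->
  (\int[mu]_s \int[mu]_u (normc (H (s, u)))%:E < +oo)%E ->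
  (forall s, cintegrable setT (fun u => H (s, u))) ->
  (forall u, cintegrable setT (fun s => H (s, u))) ->
  cintegral setT (fun s => cintegral setT (fun u => H (s, u))) =
  cintegral setT (fun u => cintegral setT (fun s => H (s, u))).
Proof.
move=> mH Hoo H1 H2; have mn := measurable_normc mH.
apply: complex_ext.
  apply: (fubini_real mH.1 mn (fun w => normrRe (H w)) Hoo).
    by move=> s; exact: (H1 s).1.
  by move=> u; exact: (H2 u).1.
apply: (fubini_real mH.2 mn (fun w => normrIm (H w)) Hoo).
  by move=> s; exact: (H1 s).2.
by move=> u; exact: (H2 u).2.
Qed.

End ComplexFubini.

(** * Euler's two integrals *)

Section GammaBeta.
Variable R : realType.
Local Notation mu := (@lebesgue_measure R).
Implicit Types (z p q : R[i]) (s t u : R).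

(** Both kernels are extended by 0 to the whole line, where the affine changes of
    variable act. *)
Definition gamma_kernel z t : R[i] :=
  if 0 < t then cpow t (z - 1) * (expR (- t))%:C else 0.

Definition beta_kernel p q t : R[i] :=
  if (0 < t) && (t < 1) then cpow t (p - 1) * cpow (1 - t) (q - 1) else 0.

Definition cBeta p q := cintegral setT (beta_kernel p q).

(** The integrals of the moduli are kept in the extended reals, so that Tonelli's
    theorem can be used to prove them finite. *)
Definition absGamma z := (\int[mu]_t (normc (gamma_kernel z t))%:E)%E.
Definition absBeta p q := (\int[mu]_t (normc (beta_kernel p q t))%:E)%E.

Lemma Euler_GammaE z : Euler_Gamma z = cintegral setT (gamma_kernel z).
Proof.
rewrite /Euler_Gamma cintegral_mkcond; apply: eq_cintegral => t _.
by rewrite /gamma_kernel mem_setE in_itv/= andbT.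
Qed.

Lemma normc_gamma_kernel z t :
  normc (gamma_kernel z t) = if 0 < t then expR ((Re z - 1) * ln t - t) else 0.
Proof.
rewrite /gamma_kernel; case: ifP => _; last exact: Normc.normc0.
rewrite Normc.normcM normc_cpow normc_real ger0_norm ?expR_ge0//.
by rewrite ReD ReN expRD.
Qed.

Lemma gamma_kernel_real s t : gamma_kernel s%:C t = (normc (gamma_kernel s%:C t))%:C.
Proof.
rewrite normc_gamma_kernel /gamma_kernel; case: ifP => // _.
have -> : s%:C - 1 = (s - 1)%:C by rewrite rmorphB.
by rewrite cpow_real -rmorphM expRD.
Qed.

Lemma cmeasurable_gamma_kernel z : cmeasurable setT (gamma_kernel z).
Proof.
apply: cmeasurable_if => //; first exact: measurable_fun_ltr.
  apply: cmeasurableM; first exact: cmeasurable_cpow.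
  apply: cmeasurable_real; apply: measurableT_comp; first exact: measurable_expR.
  exact: oppr_measurable.
Qed.

Lemma cmeasurable_beta_kernel p q : cmeasurable setT (beta_kernel p q).
Proof.
apply: cmeasurable_if => //.
- by apply: measurable_and; exact: measurable_fun_ltr.
- apply: cmeasurableM; first exact: cmeasurable_cpow.
  by apply: cmeasurable_cpow; exact: measurable_funB.
Qed.

(** The product of gamma kernels at [s] and [u - s] separates into functions of
    [u] and of [t] when [s = u * t]; the factor [u] is the Jacobian. *)
Lemma kernel_scaling p q u t : 0 < u ->
  u%:C * (gamma_kernel p (u * t) * gamma_kernel q (u - u * t)) =
  gamma_kernel (p + q) u * beta_kernel p q t.
Proof.
move=> u0; rewrite /gamma_kernel /beta_kernel u0 pmulr_rgt0// subr_gt0.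
rewrite -[X in u * t < X]mulr1 ltr_pM2l//.
case: (ltP 0 t) => [t0|_]; last by rewrite mul0r !mulr0.
case: (ltP t 1) => [t1|_] /=; last by rewrite !mulr0.
have t1' : 0 < 1 - t by rewrite subr_gt0.
have -> : u - u * t = u * (1 - t) by ring.
rewrite !cpowM//.
have eE : expR (- (u * t)) * expR (- (u * (1 - t))) = expR (- u).
  by rewrite -expRD; congr expR; ring.
have uE : cpow u (p + q - 1) = u%:C * cpow u (p - 1) * cpow u (q - 1).
  rewrite -[in RHS](expr1 u) -cpow_natr// -!cpowD; congr cpow; ring.
rewrite uE -eE rmorphM; ring.
Qed.

End GammaBeta.

Section BetaIdentity.
Variable R : realType.
Local Notation mu := (@lebesgue_measure R).
Implicit Types (z p q : R[i]) (s t u : R).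

Lemma measurable_normc_gamma_kernel z :
  measurable_fun setT (fun t : R => (normc (gamma_kernel z t))%:E).
Proof. by apply/measurable_EFinP/measurable_normc; exact: cmeasurable_gamma_kernel. Qed.

(** Since [ln x <= x - 1], a power grows more slowly than [expR (t / 2)]. *)
Lemma gamma_tail s t : 0 < s -> 1 <= t ->
  expR ((s - 1) * ln t - t) <= expR (s * ln (2 * s)) * expR (- 2^-1 * t).
Proof.
move=> s0 t1; have t0 : 0 < t by exact: lt_le_trans t1.
rewrite -expRD ler_expR.
have l0 : 0 <= ln t by exact: ln_ge0.
have : ln (t / (2 * s)) <= t / (2 * s) - 1.
  have := @le_ln1Dx _ (t / (2 * s) - 1); rewrite [1 + _]addrC subrK; apply.
  by rewrite ltrBrDr addNr divr_gt0// mulr_gt0.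
rewrite ln_div ?posrE ?mulr_gt0// => h.
have {}h : s * (ln t - ln (2 * s)) <= t / 2 - s.
  have -> : t / 2 - s = s * (t / (2 * s) - 1) by field; rewrite gt_eqF.
  by rewrite ler_pM2l.
by nra.
Qed.

(** The kernel is at most [t ^ (Re z - 1)] up to 1, and at most a multiple of an
    exponential density beyond. *)
Lemma integrable_normc_gamma_kernel z : 0 < Re z ->
  mu.-integrable setT (fun t : R => (normc (gamma_kernel z t))%:E).
Proof.
move=> z0.
pose a t := if t \in `]0, 1]%classic then (expR ((Re z - 1) * ln t))%:E else 0%E.
pose c := 2 * expR (Re z * ln (2 * Re z)).
have ia : mu.-integrable setT a.
  have h := integrable_power z0.
  rewrite integrable_mkcond in h; last by [].
  exact: h.
have ib : mu.-integrable setT (fun t => (c * exponential_pdf (2^-1) t)%:E).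
  apply: (rintegrableZ c) => //.
  by apply: integrable_exponential_pdf.
apply: (le_integrable measurableT _ _ (integrableD measurableT ia ib)).
  exact: measurable_normc_gamma_kernel.
move=> t _; rewrite /= normc_gamma_kernel.
have e0 : 0 <= c * exponential_pdf 2^-1 t.
  by rewrite !mulr_ge0 ?expR_ge0// exponential_pdf_ge0.
have a0 : (0 <= a t)%E by rewrite /a; case: ifP => // _; rewrite lee_fin expR_ge0.
rewrite [leRHS]gee0_abs ?adde_ge0//.
rewrite ger0_norm; last by case: ifP => // _; exact: expR_ge0.
case: ifPn => t0; last by rewrite adde_ge0.
rewrite /a mem_setE in_itv/= t0/=; case: (leP t 1) => t1.
  rewrite -EFinD lee_fin; apply: ler_wpDr => //; rewrite ler_expR.
  by rewrite gerBl ltW.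
rewrite add0e lee_fin exponential_pdfE ?(ltW t0)//.
apply: le_trans (gamma_tail z0 (ltW t1)) _.
by rewrite /c mulrACA divff// mul1r.
Qed.

Lemma cintegrable_gamma_kernel z : 0 < Re z -> cintegrable setT (gamma_kernel z).
Proof.
move=> z0; apply: (cintegrable_le _ (cmeasurable_gamma_kernel z)
  (integrable_normc_gamma_kernel z0)) => //.
Qed.

Lemma absGamma_fin z : 0 < Re z -> absGamma z \is a fin_num.
Proof. by move=> z0; apply: integrable_fin_num (integrable_normc_gamma_kernel z0). Qed.

(** The kernel is bounded below by a positive constant on [1, 2]. *)
Lemma absGamma_gt0 z : (0 < absGamma z)%E.
Proof.
pose m := expR (- `|Re z - 1| * ln 2 - 2).
have le : (\int[mu]_(t in `[1%R, 2%R]) m%:E <= absGamma z)%E.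
  apply: (@le_trans _ _ (\int[mu]_(t in `[1%R, 2%R]) (normc (gamma_kernel z t))%:E)%E).
    apply: ge0_le_integral => //.
    - by move=> t _; rewrite lee_fin expR_ge0.
    - exact: (measurable_funS measurableT (@subsetT _ _)
        (measurable_normc_gamma_kernel z)).
    - move=> t /=; rewrite in_itv/= => /andP[t1 t2].
      have t0 : 0 < t by exact: lt_le_trans t1.
      rewrite lee_fin normc_gamma_kernel t0 ler_expR.
      have l0 : 0 <= ln t by exact: ln_ge0.
      have l2 : ln t <= ln 2 by rewrite ler_ln ?posrE.
      have h : - (`|Re z - 1| * ln 2) <= (Re z - 1) * ln t.
        rewrite lerNl -mulNr; apply: (@le_trans _ _ (`|Re z - 1| * ln t)).
          by rewrite ler_wpM2r// lerNl -normrN lerNl ler_norm.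
        by rewrite ler_wpM2l.
      by rewrite mulNr lerB.
  apply: ge0_subset_integral => //; first exact: measurable_normc_gamma_kernel.
  by move=> t _; rewrite lee_fin normc_ge0.
apply: lt_le_trans le; rewrite integral_cst//= lebesgue_measure_itv/= lte_fin ltr1n.
by rewrite -EFinB -EFinM lte_fin mulr_gt0 ?expR_gt0// subr_gt0 ltr1n.
Qed.

Lemma Euler_Gamma_real s : 0 < s -> Euler_Gamma s%:C = (fine (absGamma s%:C))%:C.
Proof.
move=> s0; rewrite Euler_GammaE; apply: complex_ext => /=.
  rewrite /Rintegral; congr fine; apply: eq_integral => t _.
  by rewrite {1}gamma_kernel_real.
rewrite /Rintegral integral0_eq// => t _.
by rewrite gamma_kernel_real.
Qed.

Lemma absGamma_Re z : absGamma z = absGamma (Re z)%:C.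
Proof. by apply: eq_integral => t _; rewrite !normc_gamma_kernel. Qed.

End BetaIdentity.

Section BetaConvolution.
Variable R : realType.
Local Notation mu := (@lebesgue_measure R).
Implicit Types (z p q : R[i]) (s t u : R).

Let conv p q (w : R * R) : R[i] := gamma_kernel p w.1 * gamma_kernel q (w.2 - w.1).

Let mconv p q : cmeasurable setT (conv p q).
Proof.
apply: cmeasurableM.
  apply: (@cmeasurable_comp _ _ _ _ _ (gamma_kernel p) fst).
    exact: measurable_fst.
  exact: cmeasurable_gamma_kernel.
apply: (@cmeasurable_comp _ _ _ _ _ (gamma_kernel q) (fun w : R * R => w.2 - w.1)).
  by apply: measurable_funB; [exact: measurable_snd|exact: measurable_fst].
exact: cmeasurable_gamma_kernel.
Qed.

Let mnconv p q : measurable_fun setT (fun w => (normc (conv p q w))%:E).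
Proof. by apply/measurable_EFinP/measurable_normc; exact: mconv. Qed.

Let conv_neg p q s u : u <= 0 -> conv p q (s, u) = 0.
Proof.
move=> u0; rewrite /conv /gamma_kernel /=; case: ifP => [s0|_]; last by rewrite mul0r.
rewrite ifF ?mulr0//; apply/negbTE; rewrite -leNgt subr_le0.
exact: le_trans u0 (ltW s0).
Qed.

Let gamma_kernel_neg z u : u <= 0 -> gamma_kernel z u = 0.
Proof. by move=> u0; rewrite /gamma_kernel ltNge u0. Qed.

Let int_u p q s : (\int[mu]_u (normc (conv p q (s, u)))%:E =
  (normc (gamma_kernel p s))%:E * absGamma q)%E.
Proof.
rewrite /absGamma [in RHS](@ge0_integral_affine R 1 (- s))//; last 2 first.
- exact: measurable_normc_gamma_kernel.
- by move=> t; rewrite lee_fin normc_ge0.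
rewrite mul1e -ge0_integralZl//.
- by apply: eq_integral => u _; rewrite /conv Normc.normcM EFinM mul1r.
- apply: (@measurableT_comp _ _ _ _ _ _ (fun t => (normc (gamma_kernel q t))%:E) _
    (fun t : R => 1 * t - s)); first exact: measurable_normc_gamma_kernel.
  by apply: measurable_funB => //; exact: measurable_funM.
- by move=> t _; rewrite lee_fin normc_ge0.
- by rewrite lee_fin normc_ge0.
Qed.

Let measurable_normc_beta_kernel p q :
  measurable_fun setT (fun t : R => (normc (beta_kernel p q t))%:E).
Proof. by apply/measurable_EFinP/measurable_normc; exact: cmeasurable_beta_kernel. Qed.

Let int_s p q u : (\int[mu]_s (normc (conv p q (s, u)))%:E =
  (normc (gamma_kernel (p + q) u))%:E * absBeta p q)%E.
Proof.
have [u0|u0] := leP u 0.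
  rewrite gamma_kernel_neg// Normc.normc0 mul0e integral0_eq// => s _.
  by rewrite conv_neg// Normc.normc0.
have mc : measurable_fun setT (fun s => (normc (conv p q (s, u)))%:E).
  exact: (measurableT_comp (mnconv p q) (measurable_pair2 u)).
have n0 s : (0 <= (normc (conv p q (s, u)))%:E)%E by rewrite lee_fin normc_ge0.
rewrite (@ge0_integral_affine R u 0)// -!ge0_integralZl//.
- apply: eq_integral => t _; rewrite -!EFinM; congr (_%:E).
  rewrite -[RHS]Normc.normcM -kernel_scaling// [RHS]Normc.normcM normc_real.
  by rewrite ger0_norm ?(ltW u0)// addr0.
- exact: measurable_normc_beta_kernel.
- by move=> t _; rewrite lee_fin normc_ge0.
- by rewrite lee_fin normc_ge0.
- apply: (@measurableT_comp _ _ _ _ _ _ _ _ (fun t : R => u * t + 0) mc).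
  by apply: measurable_funD => //; exact: measurable_funM.
- by rewrite lee_fin ltW.
Qed.

(** Tonelli's theorem for the convolution of the moduli. When [Re p] and [Re q]
    are positive the left-hand side is finite, and as [absGamma (p + q)] is not 0
    the beta integral converges. *)
Lemma absGamma_absBeta p q :
  (absGamma p * absGamma q = absGamma (p + q)%R * absBeta p q)%E.
Proof.
have absB0 : (0 <= absBeta p q)%E.
  by apply: integral_ge0 => t _; rewrite lee_fin normc_ge0.
have absG0 z : (0 <= absGamma z)%E by exact: ltW (absGamma_gt0 _).
rewrite muleC [RHS]muleC.
transitivity (\int[mu]_s \int[mu]_u (normc (conv p q (s, u)))%:E)%E.
  under [RHS]eq_integral do rewrite int_u muleC.
  rewrite ge0_integralZl//; first exact: measurable_normc_gamma_kernel.
  by move=> t _; rewrite lee_fin normc_ge0.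
have nn0 w : (0 <= (normc (conv p q w))%:E)%E by rewrite lee_fin normc_ge0.
transitivity (\int[mu]_u \int[mu]_s (normc (conv p q (s, u)))%:E)%E.
  exact: (@fubini_tonelli _ _ _ _ R mu mu _ (mnconv p q) nn0).
under eq_integral do rewrite int_s muleC.
rewrite ge0_integralZl//; first exact: measurable_normc_gamma_kernel.
by move=> t _; rewrite lee_fin normc_ge0.
Qed.

Lemma absBeta_fin p q : 0 < Re p -> 0 < Re q -> (absBeta p q < +oo)%E.
Proof.
move=> p0 q0; have := absGamma_absBeta p q; rewrite ltey.
apply: contra_eqN => /eqP ->; rewrite gt0_muley ?absGamma_gt0//.
by apply/eqP => /(congr1 (fun x => x \is a fin_num)); rewrite fin_numM ?absGamma_fin.
Qed.

Lemma integrable_normc_beta_kernel p q : 0 < Re p -> 0 < Re q ->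
  mu.-integrable setT (fun t : R => (normc (beta_kernel p q t))%:E).
Proof.
move=> p0 q0; apply/integrableP; split; first exact: measurable_normc_beta_kernel.
under eq_integral do rewrite gee0_abs ?lee_fin ?normc_ge0//.
exact: absBeta_fin.
Qed.

Lemma cintegrable_beta_kernel p q : 0 < Re p -> 0 < Re q ->
  cintegrable setT (beta_kernel p q).
Proof.
move=> p0 q0; apply: (cintegrable_le _ (cmeasurable_beta_kernel p q)
  (integrable_normc_beta_kernel p0 q0)) => //.
Qed.

(** The product of the two integrals is the integral of the convolution of the
    two kernels, whose value at [u] is, by scaling, the kernel of
    [Euler_Gamma (p + q)] times the beta integral. *)
Lemma Gamma_Beta p q : 0 < Re p -> 0 < Re q ->
  Euler_Gamma p * Euler_Gamma q = Euler_Gamma (p + q) * cBeta p q.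
Proof.
move=> p0 q0; have pq0 : 0 < Re (p + q) by rewrite ReD addr_gt0.
have iu s : cintegral setT (fun u => conv p q (s, u)) =
    gamma_kernel p s * cintegral setT (gamma_kernel q).
  have iq := cintegrable_gamma_kernel q0.
  transitivity (cintegral setT (fun u => gamma_kernel p s * gamma_kernel q (1 * u - s))).
    by apply: eq_cintegral => u _; rewrite /conv /= mul1r.
  have eq1 := @cintegral_affine R 1 (- s) _ ltr01 iq.
  have iq1 := @cintegrable_affine R 1 (- s) _ ltr01 iq.
  by rewrite eq1 rmorph1 mul1r; exact: cintegralZ iq1.
have ciu s : cintegrable setT (fun u => conv p q (s, u)).
  apply: (@cintegrableZ R setT (gamma_kernel p s)
    (fun u => gamma_kernel q (u - s))) => //.
  have := @cintegrable_affine R 1 (- s) _ ltr01 (cintegrable_gamma_kernel q0).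
  by apply: eq_cintegrable => // t _; rewrite mul1r.
have cis u : cintegrable setT (fun s => conv p q (s, u)).
  apply: (@cintegrable_le _ _ _ (fun s => normc (conv p q (s, u)))) => //.
    have [m1 m2] := mconv p q; split.
      exact: (measurableT_comp m1 (measurable_pair2 u)).
    exact: (measurableT_comp m2 (measurable_pair2 u)).
  apply/integrableP; split.
    exact: (measurableT_comp (mnconv p q) (measurable_pair2 u)).
  under eq_integral do rewrite gee0_abs ?lee_fin ?normc_ge0//.
  by rewrite int_s lte_mul_pinfty ?lee_fin ?normc_ge0 ?absBeta_fin.
have is_ u : cintegral setT (fun s => conv p q (s, u)) =
    gamma_kernel (p + q) u * cBeta p q.
  have [u0|u0] := leP u 0.
    rewrite gamma_kernel_neg// mul0r /cintegral /Rintegral !integral0_eq// => s _;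
    by rewrite conv_neg.
  rewrite (@cintegral_affine R u 0)// -!cintegralZ//.
  - apply: eq_cintegral => t _; rewrite addr0 -kernel_scaling//.
  - exact: cintegrable_beta_kernel.
  - exact: (cintegrable_affine 0 u0 (cis u)).
have E1 : Euler_Gamma p * Euler_Gamma q =
    cintegral setT (fun s => cintegral setT (gamma_kernel q) * gamma_kernel p s).
  rewrite !Euler_GammaE mulrC; apply/esym/cintegralZ => //.
  exact: cintegrable_gamma_kernel.
have E2 : Euler_Gamma (p + q) * cBeta p q =
    cintegral setT (fun u => cBeta p q * gamma_kernel (p + q) u).
  rewrite Euler_GammaE mulrC; apply/esym/cintegralZ => //.
  exact: cintegrable_gamma_kernel.
rewrite E1 E2.
transitivity (cintegral setT (fun s => cintegral setT (fun u => conv p q (s, u)))).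
  by apply: eq_cintegral => s _; rewrite iu mulrC.
rewrite (cfubini (mconv p q))//.
  by apply: eq_cintegral => u _; rewrite is_ mulrC.
under eq_integral do rewrite int_u muleC.
rewrite ge0_integralZl//.
- rewrite -/(absGamma p) lte_mul_pinfty ?absGamma_fin// ?ltW ?absGamma_gt0//.
  by have := absGamma_fin p0; rewrite fin_numElt => /andP[].
- exact: measurable_normc_gamma_kernel.
- by move=> t _; rewrite lee_fin normc_ge0.
- by rewrite ltW// absGamma_gt0.
Qed.

Lemma Euler_Gamma1 : Euler_Gamma (1 : R[i]) = 1.
Proof.
rewrite -[in LHS](rmorph1 (real_complex R)) Euler_Gamma_real//.
rewrite -[RHS](rmorph1 (real_complex R)); congr (_%:C).
rewrite -[RHS]/(fine 1%E); congr fine.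
rewrite -(@integral_exponential_pdf R 1 ltr01) /absGamma.
transitivity (\int[mu]_(t in `]0%R, +oo[) (expR (- t))%:E)%E.
  rewrite [RHS]integral_mkcond; apply: eq_integral => t _.
  rewrite patchE mem_setE in_itv/= andbT normc_gamma_kernel /=.
  by case: ifP; rewrite ?subrr ?mul0r ?add0r.
have mexpN : measurable_fun setT (fun t : R => (expR (- t))%:E).
  apply/measurable_EFinP/measurableT_comp; first exact: measurable_expR.
  exact: oppr_measurable.
rewrite integral_itv_obnd_cbnd; last exact: measurable_funTS.
rewrite integral_mkcond; apply: eq_integral => t _.
rewrite /exponential_pdf !patchE; case: ifP => //.
by rewrite mulN1r mul1r.
Qed.

Lemma cBeta1 z : 0 < Re z -> cBeta z 1 = z^-1.
Proof.
move=> z0; rewrite -cintegral_power//.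
transitivity (cintegral `]0, 1[ (fun t : R => cpow t (z - 1))).
  rewrite cintegral_mkcond; apply: eq_cintegral => t _.
  by rewrite mem_setE in_itv/= /beta_kernel subrr cpow0 mulr1.
have [i1 i2] := cintegrable_power z0.
have sub : (`]0, 1[ : set R) `<=` `]0, 1].
  by move=> t /=; rewrite !in_itv/= => /andP[-> /ltW].
by congr (_ +i* _); rewrite Rintegral_itv_bndo_bndc//;
  [apply: integrableS i1|apply: integrableS i2].
Qed.

(** This is [Gamma_Beta] for [q = 1]: the beta integral is then [z^-1]. *)
Lemma Euler_GammaS z : 0 < Re z -> Euler_Gamma (z + 1) = z * Euler_Gamma z.
Proof.
move=> z0; have := Gamma_Beta z0 (_ : 0 < Re 1); rewrite Euler_Gamma1 mulr1.
move=> -> //; rewrite cBeta1// mulrC divfK//.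
by apply: contraTneq z0 => ->; rewrite ltxx.
Qed.

End BetaConvolution.

(** * A lower bound for the Gamma function *)

Section GammaLowerBound.
Variable R : realType.
Local Notation mu := (@lebesgue_measure R).
Implicit Types (z : R[i]) (s t u x y tau : R).

Lemma normr_sin_le x : 0 <= x -> `|sin x| <= x.
Proof.
move=> x0.
have cs : {within `[0, x], continuous (@sin R)}.
  by apply: continuous_subspaceT; exact: continuous_sin.
have [c _] := @MVT_segment R sin cos 0 x x0 (fun y _ => is_derive_sin y) cs.
rewrite sin0 !subr0 => ->; rewrite normrM (ger0_norm x0) ler_piMl//.
exact: cos_max.
Qed.

Lemma cos_lower x : 1 - x ^+ 2 / 2 <= cos x.
Proof.
have sn y : 0 <= y -> 1 - (y *+ 2) ^+ 2 / 2 <= cos (y *+ 2).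
  move=> y0; rewrite cos_mulr2n cos2sin2.
  have : sin y ^+ 2 <= y ^+ 2.
    by rewrite -(real_normK (num_real (sin y))) lerXn2r ?nnegrE ?normr_sin_le.
  nra.
have half y : y = (y / 2) *+ 2 by rewrite -mulr_natr divfK.
have [x0|x0] := leP 0 x.
  by rewrite (half x); apply: sn; rewrite divr_ge0.
rewrite -cosN -sqrrN (half (- x)).
by apply: sn; rewrite divr_ge0// oppr_ge0 ltW.
Qed.

(** With [y = x / 2 >= 0], square [y <= expR y - expR (- y)]. *)
Lemma sqr_le_expR x : x ^+ 2 <= 4 * (expR x + expR (- x) - 2).
Proof.
wlog x0 : x / 0 <= x => [hw|].
  have [|/ltW x0] := leP 0 x; first exact: hw.
  by have := hw (- x); rewrite sqrrN opprK (addrC (expR (- x))) oppr_ge0; apply.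
pose a := expR (x / 2); pose b := expR (- (x / 2)).
have aa : expR x = a * a by rewrite -expRD -splitr.
have bb : expR (- x) = b * b by rewrite -expRD -opprD -splitr.
have ab : a * b = 1 by rewrite -expRD subrr expR0.
have a1 : 1 + x / 2 <= a by exact: expR_ge1Dx.
have b1 : b <= 1 by rewrite expR_le1 oppr_le0 divr_ge0.
have h : x / 2 <= a - b by lra.
have : (x / 2) ^+ 2 <= (a - b) ^+ 2 by rewrite lerXn2r ?nnegrE ?divr_ge0//; lra.
rewrite aa bb; nra.
Qed.

(** For large [s] the gamma density of parameter [s] concentrates near [s]. This
    bound on the real part of [(t / s) ^ (i tau)] involves only [t] and [1 / t],
    whose integrals against the density follow from the functional equation. *)
Lemma cos_log_lower tau s t : 0 < s -> 0 < t ->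
  1 - 2 * tau ^+ 2 * (t / s + s / t - 2) <= cos (tau * (ln t - ln s)).
Proof.
move=> s0 t0; apply: le_trans (cos_lower _).
have h := sqr_le_expR (ln t - ln s).
have e1 : expR (ln t - ln s) = t / s by rewrite -ln_div ?posrE// lnK ?posrE ?divr_gt0.
have e2 : expR (- (ln t - ln s)) = s / t.
  by rewrite opprB -ln_div ?posrE// lnK ?posrE ?divr_gt0.
rewrite e1 e2 in h; rewrite exprMn.
have := sqr_ge0 tau; nra.
Qed.

Definition realGamma s := fine (absGamma s%:C).

Lemma realGammaE s : 0 < s -> Euler_Gamma s%:C = (realGamma s)%:C.
Proof. exact: Euler_Gamma_real. Qed.

Lemma realGamma_gt0 s : 0 < s -> 0 < realGamma s.
Proof.
move=> s0; rewrite fine_gt0// absGamma_gt0/=.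
by have := @absGamma_fin R s%:C s0; rewrite fin_numElt => /andP[].
Qed.

Lemma realGammaS s : 0 < s -> realGamma (s + 1) = s * realGamma s.
Proof.
move=> s0; have := @Euler_GammaS R s%:C s0.
have -> : s%:C + 1 = (s + 1)%:C by rewrite rmorphD rmorph1.
by rewrite !realGammaE ?addr_gt0// -rmorphM => /complexI.
Qed.

Lemma realGamma_int z :
  realGamma (Re z) = Rintegral mu setT (fun t => normc (gamma_kernel z t)).
Proof. by rewrite /realGamma -absGamma_Re. Qed.

(** The constant 2 comes from bounding the real and imaginary parts separately. *)
Lemma Euler_Gamma_upper z : 0 < Re z -> normc (Euler_Gamma z) <= 2 * realGamma (Re z).
Proof.
move=> z0; rewrite Euler_GammaE realGamma_int.
have [i1 i2] := cintegrable_gamma_kernel z0.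
have ign := integrable_normc_gamma_kernel z0.
apply: le_trans (normc_le _) _; rewrite mulr2n mulrDl mul1r; apply: lerD => /=.
  apply: le_trans (le_normr_Rintegral _ i1) _ => //.
  apply: le_Rintegral => //; last by move=> t _; exact: normrRe.
  exact: (integrable_abse i1).
apply: le_trans (le_normr_Rintegral _ i2) _ => //.
apply: le_Rintegral => //; last by move=> t _; exact: normrIm.
exact: (integrable_abse i2).
Qed.

Lemma normc_gamma_kernel_shift s t r : 0 < t ->
  normc (gamma_kernel (s + r)%:C t) = normc (gamma_kernel s%:C t) * expR (r * ln t).
Proof. by move=> t0; rewrite !normc_gamma_kernel t0/= -expRD; congr expR; ring. Qed.

(** Multiplication by the unit [s ^ (- i tau)] turns the real part of the integrand
    into the density times [cos (tau * (ln t - ln s))], and [cos_log_lower]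
    integrates to [realGamma s * (1 - 2 * tau ^+ 2 / (s - 1))]. *)
Lemma Euler_Gamma_lower_large s tau : 2 + 4 * tau ^+ 2 <= s ->
  realGamma s / 2 <= normc (Euler_Gamma (s +i* tau)).
Proof.
move=> hs; have t20 := sqr_ge0 tau.
have s1 : 1 < s by lra.
have s0 : 0 < s by lra.
set z := s +i* tau.
have z0 : 0 < Re z by [].
pose w := cpow s (0 -i* tau).
have w1 : normc w = 1 by rewrite normc_cpow /= mul0r expR0.
have -> : normc (Euler_Gamma z) = normc (w * Euler_Gamma z).
  by rewrite Normc.normcM w1 mul1r.
rewrite Euler_GammaE -cintegralZ//; last first.
  exact: cintegrable_gamma_kernel.
apply: le_trans (le_trans (ler_norm _) (normrRe _)) => /=.
have iw : cintegrable setT (fun t => w * gamma_kernel z t).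
  by apply: cintegrableZ => //; exact: cintegrable_gamma_kernel.
pose k r t := normc (gamma_kernel r%:C t).
have ik r : 0 < r -> mu.-integrable setT (EFin \o k r).
  by move=> r0; exact: (@integrable_normc_gamma_kernel R r%:C).
(* The coefficients of 1, t and 1 / t in the bound of cos_log_lower. *)
pose c1 := 1 + 4 * tau ^+ 2; pose c2 := - (2 * tau ^+ 2 / s).
pose c3 := - (2 * tau ^+ 2 * s).
have iL : mu.-integrable setT (EFin \o (fun t => c1 * k s t + c2 * k (s + 1) t)).
  by apply: (integrableD measurableT (rintegrableZ c1 _ _) (rintegrableZ c2 _ _)) => //;
    apply: ik; lra.
have i3 : mu.-integrable setT (EFin \o (fun t => c3 * k (s - 1) t)).
  by apply: (rintegrableZ c3) => //; apply: ik; lra.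
apply: (@le_trans _ _ (Rintegral mu setT (fun t =>
    (c1 * k s t + c2 * k (s + 1) t) + c3 * k (s - 1) t))); last first.
  apply: le_Rintegral => //.
  - exact: (integrableD measurableT iL i3).
  - exact: iw.1.
  - move=> t _.
    case: (ltP 0 t) => [t0|t0]; last first.
      have g0 z' : gamma_kernel z' t = 0 by rewrite /gamma_kernel ltNge t0.
      by rewrite /k !g0 Normc.normc0 !mulr0 !addr0.
    have -> : Re (w * gamma_kernel z t) = k s t * cos (tau * (ln t - ln s)).
      have cE : cos (tau * (ln t - ln s)) =
          cos (- tau * ln s) * cos (tau * ln t) - sin (- tau * ln s) * sin (tau * ln t).
        by rewrite -cosD; congr cos; ring.
      rewrite cE /gamma_kernel t0 mulrA mulrC ReMr ReM /w !Re_cpow !Im_cpow !compE /=.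
      rewrite mul0r expR0 !mul1r oppr0 addr0 /k normc_gamma_kernel t0 /= expRD.
      by ring.
    have kp : k (s + 1) t = k s t * t.
      by rewrite /k normc_gamma_kernel_shift// mul1r lnK.
    have km : k (s - 1) t = k s t / t.
      by rewrite /k normc_gamma_kernel_shift// mulN1r expRN lnK.
    rewrite kp km.
    have := ler_wpM2l (normc_ge0 (gamma_kernel s%:C t)) (cos_log_lower tau s0 t0).
    apply: le_trans; rewrite -/(k s t) /c1 /c2 /c3.
    rewrite le_eqVlt; apply/orP; left; apply/eqP.
    by field; rewrite !gt_eqF.
have i1 : mu.-integrable setT (EFin \o (fun t => c1 * k s t)).
  by apply: (rintegrableZ c1) => //; exact: ik.
have i2 : mu.-integrable setT (EFin \o (fun t => c2 * k (s + 1) t)).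
  by apply: (rintegrableZ c2) => //; apply: ik; rewrite addr_gt0.
rewrite RintegralD// RintegralD// !RintegralZl//; try (apply: ik; lra).
rewrite -!(realGamma_int (_ %:C)) /= realGammaS//.
have gE : realGamma s = (s - 1) * realGamma (s - 1).
  by rewrite -realGammaS ?subrK// subr_gt0.
have g0 : 0 < realGamma (s - 1) by apply: realGamma_gt0; rewrite subr_gt0.
rewrite /c1 /c2 /c3 gE.
set g := realGamma (s - 1) in g0 *.
have -> : (1 + 4 * tau ^+ 2) * ((s - 1) * g) + - (2 * tau ^+ 2 / s) *
    (s * ((s - 1) * g)) + - (2 * tau ^+ 2 * s) * g
    = g * (s - 1 - 2 * tau ^+ 2).
  by field; rewrite gt_eqF.
have -> : (s - 1) * g / 2 = g * ((s - 1) / 2) by ring.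
by rewrite ler_pM2l//; lra.
Qed.

(** The functional equation carries the bound from large real parts down to any
    half-plane [s <= Re z] with [0 < s]; in particular Gamma has no zero there. *)
Lemma Euler_Gamma_lower tau s : 0 < s -> exists2 c, 0 < c &
  forall x, s <= x -> c * realGamma x <= normc (Euler_Gamma (x +i* tau)).
Proof.
have [n] : exists n : nat, 2 + 4 * tau ^+ 2 - s <= n%:R.
  exists (Num.truncn (2 + 4 * tau ^+ 2 - s)).+1; apply: ltW.
  exact: truncnS_gt.
elim: n s => [|n IH] s hn s0.
  exists (2^-1) => // x sx; rewrite mulrC; apply: Euler_Gamma_lower_large.
  by apply: le_trans sx; rewrite -subr_le0.
have [||c c0 hc] := IH (s + 1); [|by rewrite addr_gt0|].
  by rewrite opprD addrA lerBlDr natr1.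
exists (c * (s / (s + `|tau|))) => [|x sx].
  by rewrite mulr_gt0// divr_gt0// ltr_wpDr.
have x0 : 0 < x by exact: lt_le_trans sx.
have := hc (x + 1); rewrite lerD2r => /(_ sx); rewrite realGammaS//.
have -> : (x + 1) +i* tau = (x +i* tau) + 1.
  by apply: complex_ext; rewrite ?(ReD, ImD) /= ?addr0.
rewrite Euler_GammaS// Normc.normcM => h.
have nz : normc (x +i* tau) <= x + `|tau|.
  by apply: le_trans (normc_le _) _; rewrite /= (ger0_norm (ltW x0)).
have := normc_ge0 (Euler_Gamma (x +i* tau)); set G := normc (Euler_Gamma _) => G0.
have {}h : c * (x * realGamma x) <= (x + `|tau|) * G.
  by apply: le_trans h _; rewrite ler_wpM2r.
have xt : 0 < x + `|tau| by rewrite ltr_wpDr.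
apply: (@le_trans _ _ (c * (x / (x + `|tau|)) * realGamma x)).
  rewrite ler_wpM2r ?(ltW (realGamma_gt0 x0))// ler_wpM2l ?(ltW c0)//.
  rewrite ler_pdivrMr ?ltr_wpDr// mulrAC ler_pdivlMr// !mulrDr (mulrC s x) lerD2l.
  by rewrite ler_wpM2r.
have -> : c * (x / (x + `|tau|)) * realGamma x = c * (x * realGamma x) / (x + `|tau|).
  by ring.
by rewrite ler_pdivrMr// [leRHS]mulrC.
Qed.

Lemma Euler_Gamma_neq0 z : 0 < Re z -> Euler_Gamma z != 0.
Proof.
case: z => x tau /= x0; have [c c0 /(_ x (lexx x))] := Euler_Gamma_lower tau x0.
move=> h; apply/eqP => g0; move: h; rewrite g0 Normc.normc0 leNgt => /negP; apply.
by rewrite mulr_gt0// realGamma_gt0.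
Qed.

End GammaLowerBound.

(** * Absolutely convergent series of complex numbers *)

Section ComplexSeries.
Variable R : realType.
Implicit Types (u : nat -> R[i]) (l : R[i]).

Lemma ccvg_cvg u l : ccvg u l -> (u : nat -> R[i]^o) @ \oo --> (l : R[i]^o).
Proof.
move=> [cR cI]; apply/cvgrPdist_lt => -[e e'] /=.
rewrite ltcE/= => /andP[/eqP -> e0].
have e20 : 0 < e / 2 by rewrite divr_gt0.
near=> n.
have -> : `|(l : R[i]^o) - u n| = (normc (l - u n))%:C by [].
have -> : e +i* 0 = e%:C by [].
rewrite ltcR (splitr e); apply: le_lt_trans (normc_le _) _.
rewrite ReD ReN ImD ImN; apply: ltrD.
  by near: n; move/cvgrPdist_lt : cR => /(_ _ e20).
by near: n; move/cvgrPdist_lt : cI => /(_ _ e20).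
Unshelve. all: end_near. Qed.

Definition csum u : R[i] := limn (series (u : nat -> R[i]^o)).

Definition nsum u : \bar R := (\sum_(0 <= n <oo) (normc (u n))%:E)%E.

Lemma nsum_ge0 u : (0 <= nsum u)%E.
Proof. by apply: nneseries_ge0 => n _ _; rewrite lee_fin normc_ge0. Qed.

Lemma Re_series u n : Re (series (u : nat -> R[i]^o) n) = series (fun k => Re (u k)) n.
Proof.
rewrite /series /=; elim/big_ind2 : _ => // x1 x2 y1 y2 <- <-; exact: ReD.
Qed.

Lemma Im_series u n : Im (series (u : nat -> R[i]^o) n) = series (fun k => Im (u k)) n.
Proof.
rewrite /series /=; elim/big_ind2 : _ => // x1 x2 y1 y2 <- <-; exact: ImD.
Qed.

Lemma normc_series u n : normc (series (u : nat -> R[i]^o) n) <=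
  series (fun k => normc (u k)) n.
Proof.
rewrite /series /=; elim/big_ind2 : _ => [|x1 x2 y1 y2 h1 h2|//].
  by rewrite Normc.normc0.
exact: le_trans (le_normcD _ _) (lerD h1 h2).
Qed.

Lemma series_le_nsum u n : ((series (fun k => normc (u k)) n)%:E <= nsum u)%E.
Proof.
rewrite /series /= -sumEFin; apply: nneseries_lim_ge => k _ _.
by rewrite lee_fin normc_ge0.
Qed.

(** Serves for the real parts and for the imaginary parts of [u]. *)
Lemma dominated_series_cvg u (v : nat -> R) : (nsum u < +oo)%E ->
  (forall n, `|v n| <= normc (u n)) -> cvgn (series v).
Proof.
move=> uoo vu; apply: normed_cvg; apply: nondecreasing_is_cvgn.
  by apply: nondecreasing_series => n _ _; exact: normr_ge0.
exists (fine (nsum u)) => _ [n _ <-].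
have fu : nsum u \is a fin_num by rewrite ge0_fin_numE ?nsum_ge0.
rewrite -lee_fin fineK//; apply: le_trans (series_le_nsum u n).
by rewrite lee_fin; apply: ler_sum => k _; exact: vu.
Qed.

Lemma csum_cvg u : (nsum u < +oo)%E ->
  ccvg (fun n => series (u : nat -> R[i]^o) n) (csum u).
Proof.
move=> uoo.
have cR := dominated_series_cvg uoo (fun n => normrRe (u n)).
have cI := dominated_series_cvg uoo (fun n => normrIm (u n)).
pose l := limn (series (fun n => Re (u n))) +i* limn (series (fun n => Im (u n))).
have cl : ccvg (fun n => series (u : nat -> R[i]^o) n) l.
  by split; [under eq_fun do rewrite Re_series|under eq_fun do rewrite Im_series].
suff -> : csum u = l by [].
exact: (@norm_cvg_lim _ R[i]^o _ _ _ (ccvg_cvg cl)).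
Qed.

Lemma csum_ccvg u l : ccvg (fun n => series (u : nat -> R[i]^o) n) l -> csum u = l.
Proof. by move=> ul; exact: (@norm_cvg_lim _ R[i]^o _ _ _ (ccvg_cvg ul)). Qed.

Lemma normc_csum u : (nsum u < +oo)%E -> ((normc (csum u))%:E <= nsum u)%E.
Proof.
move=> uoo; have [cR cI] := csum_cvg uoo.
have fu : nsum u \is a fin_num by rewrite ge0_fin_numE ?nsum_ge0.
have cN : (fun n => normc (series (u : nat -> R[i]^o) n)) @ \oo --> normc (csum u).
  have nE (z : R[i]) : normc z = Num.sqrt (Re z * Re z + Im z * Im z) by case: z.
  rewrite nE; under eq_fun do rewrite nE.
  by apply: (continuous_cvg _ (@sqrt_continuous R _)); apply: cvgD; exact: cvgM.
rewrite -(fineK fu) lee_fin; apply: (cvgr_to_le cN); apply: nearW => n.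
rewrite -lee_fin fineK//; apply: le_trans (series_le_nsum u n).
by rewrite lee_fin normc_series.
Qed.

Lemma csumZ (c : R[i]) u : (nsum u < +oo)%E ->
  csum (fun n => c * u n) = c * csum u.
Proof.
move=> uoo; apply: csum_ccvg; have [cR cI] := csum_cvg uoo.
have sE n : series ((fun k => c * u k) : nat -> R[i]^o) n =
    c * series (u : nat -> R[i]^o) n by rewrite /series /= mulr_sumr.
split.
  under eq_fun do rewrite sE ReM; rewrite ReM.
  by apply: cvgB; apply: cvgM => //; exact: cvg_cst.
under eq_fun do rewrite sE ImM; rewrite ImM.
by apply: cvgD; apply: cvgM => //; exact: cvg_cst.
Qed.

End ComplexSeries.

(** * Termwise integration *)

Section TermwiseIntegration.
Variable R : realType.
Local Notation mu := (@lebesgue_measure R).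
Variables (D : set R) (mD : measurable D).

(** The partial sums are dominated by the sum of the moduli, which is integrable
    by monotone convergence. *)
Lemma cintegral_csum (f : nat -> R -> R[i]) :
  (forall n, cmeasurable D (f n)) ->
  (forall t, D t -> (nsum (f ^~ t) < +oo)%E) ->
  (\sum_(0 <= n <oo) \int[mu]_(t in D) (normc (f n t))%:E < +oo)%E ->
  cintegrable D (fun t => csum (f ^~ t)) /\
  csum (fun n => cintegral D (f n)) = cintegral D (fun t => csum (f ^~ t)).
Proof.
move=> mf fsum foo.
have mn n : measurable_fun D (fun t => (normc (f n t))%:E).
  by apply/measurable_EFinP/measurable_normc; exact: mf.
have n0 n t : (0 <= (normc (f n t))%:E)%E by rewrite lee_fin normc_ge0.
pose g t := fine (nsum (f ^~ t)).
have gE t : D t -> (g t)%:E = nsum (f ^~ t).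
  by move=> Dt; rewrite /g fineK// ge0_fin_numE ?nsum_ge0 ?fsum.
have ig : mu.-integrable D (EFin \o g).
  have mns : measurable_fun D (fun t => nsum (f ^~ t)).
    by apply: ge0_emeasurable_sum.
  have ins : mu.-integrable D (fun t => nsum (f ^~ t)).
    apply/integrableP; split => //.
    under eq_integral do rewrite gee0_abs ?nsum_ge0//.
    by rewrite integral_nneseries.
  by apply: eq_integrable ins => // t /set_mem Dt /=; rewrite gE.
have in_ n : cintegrable D (f n).
  apply: (cintegrable_le mD (mf n) ig) => t Dt.
  rewrite -lee_fin gE//; apply: le_trans (series_le_nsum (f ^~ t) n.+1).
  rewrite lee_fin /series /= big_nat_recr//= lerDr sumr_ge0// => k _.
  exact: normc_ge0.
pose s_ n t := series ((f ^~ t) : nat -> R[i]^o) n.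
have sS n t : s_ n.+1 t = s_ n t + f n t by rewrite /s_ /series /= big_nat_recr.
have cs n : cintegrable D (s_ n) /\
    cintegral D (s_ n) = series ((fun n => cintegral D (f n)) : nat -> R[i]^o) n.
  elim: n => [|n [[i1 i2] IH]].
    have s0 : s_ 0 = fun=> 0 by apply/funext => t; rewrite /s_ /series /= big_nil.
    rewrite s0; split; first by split; exact: integrable0.
    by rewrite /series /= big_nil /cintegral /Rintegral !integral0.
  have [j1 j2] := in_ n.
  have -> : s_ n.+1 = fun t => s_ n t + f n t by apply/funext => t; rewrite sS.
  split.
    split.
      under eq_fun do rewrite ReD EFinD.
      exact: integrableD.
    under eq_fun do rewrite ImD EFinD.
    exact: integrableD.
  rewrite [RHS](_ : _ = cintegral D (s_ n) + cintegral D (f n)); last first.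
    by rewrite IH /series /= big_nat_recr.
  apply: complex_ext.
    rewrite ReD /=; under eq_Rintegral do rewrite ReD.
    by rewrite RintegralD.
  rewrite ImD /=; under eq_Rintegral do rewrite ImD.
  by rewrite RintegralD.
have [|||||icsum ccsum] := @cdominated_cvg R D s_ (fun t => csum (f ^~ t)) g.
- exact: mD.
- by move=> n; have [[i1 i2] _] := cs n; split;
    apply/measurable_EFinP;
    [exact: (measurable_int mu i1)|exact: (measurable_int mu i2)].
- by move=> t Dt; exact: csum_cvg (fsum t Dt).
- exact: ig.
- move=> n t Dt; rewrite -lee_fin gE//; apply: le_trans (series_le_nsum (f ^~ t) n).
  by rewrite lee_fin normc_series.
split=> //; apply: csum_ccvg.
rewrite (_ : (fun n => _) = fun n => cintegral D (s_ n))//.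
by apply/funext => n; rewrite (cs n).2.
Qed.

(** The case of simple series is applied to each row, and then to the row sums,
    whose moduli are at most the row sums of the moduli. *)
Lemma cintegral_csum2 (f : nat -> nat -> R -> R[i]) :
  (forall m n, cmeasurable D (f m n)) ->
  (forall t, D t -> (\sum_(0 <= m <oo) nsum (fun n => f m n t) < +oo)%E) ->
  (\sum_(0 <= m <oo) \sum_(0 <= n <oo)
     \int[mu]_(t in D) (normc (f m n t))%:E < +oo)%E ->
  cintegrable D (fun t => csum (fun m => csum (fun n => f m n t))) /\
  csum (fun m => csum (fun n => cintegral D (f m n))) =
  cintegral D (fun t => csum (fun m => csum (fun n => f m n t))).
Proof.
move=> mf fsum foo.
have mn m n : measurable_fun D (fun t => (normc (f m n t))%:E).
  by apply/measurable_EFinP/measurable_normc; exact: mf.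
have term (a : nat -> \bar R) m : (forall n, 0 <= a n)%E ->
    (\sum_(0 <= n <oo) a n < +oo)%E -> (a m < +oo)%E.
  move=> a0; apply: le_lt_trans.
  apply: le_trans (nneseries_lim_ge m.+1 (fun n _ _ => a0 n)).
  by rewrite big_nat_recr//= leeDr// sume_ge0.
have row m t : D t -> (nsum (fun n => f m n t) < +oo)%E.
  by move=> Dt; apply: (term (fun m => nsum (fun n => f m n t))) (fsum t Dt) => n;
    exact: nsum_ge0.
have irow m : (\sum_(0 <= n <oo) \int[mu]_(t in D) (normc (f m n t))%:E < +oo)%E.
  apply: (term (fun m =>
    \sum_(0 <= n <oo) \int[mu]_(t in D) (normc (f m n t))%:E)%E) foo => k.
  apply: nneseries_ge0 => n _ _; apply: integral_ge0 => t _.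
  by rewrite lee_fin normc_ge0.
have R1 m := cintegral_csum (mf m) (row m) (irow m).
pose g m t := csum (fun n => f m n t).
have mg m : cmeasurable D (g m).
  by have [[i1 i2] _] := R1 m; split;
    apply/measurable_EFinP;
    [exact: (measurable_int mu i1)|exact: (measurable_int mu i2)].
have gsum t : D t -> (nsum (g ^~ t) < +oo)%E.
  move=> Dt; apply: le_lt_trans (fsum t Dt); apply: lee_nneseries.
    by move=> m _ _; rewrite lee_fin normc_ge0.
  by move=> m _; exact: normc_csum (row m t Dt).
have goo : (\sum_(0 <= m <oo) \int[mu]_(t in D) (normc (g m t))%:E < +oo)%E.
  apply: le_lt_trans foo; apply: lee_nneseries => m _.
    by move=> _; apply: integral_ge0 => t _; rewrite lee_fin normc_ge0.
  rewrite -integral_nneseries//; last 2 first.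
  - by move=> n; exact: mn.
  - by move=> n t _; rewrite lee_fin normc_ge0.
  apply: ge0_le_integral => //.
  - by move=> t _; rewrite lee_fin normc_ge0.
  - by apply/measurable_EFinP/measurable_normc; exact: mg.
  - apply: ge0_emeasurable_sum => [n t _ _|n _]; last exact: mn.
    by rewrite lee_fin normc_ge0.
  - by move=> t Dt; exact: normc_csum (row m t Dt).
have [ig E] := cintegral_csum mg gsum goo.
split=> //; rewrite -E; congr csum; apply/funext => m.
by rewrite (R1 m).2.
Qed.

End TermwiseIntegration.

(** * The integral representation *)

Section Representation.
Variable R : realType.

Lemma GammaE (z : R[i]) : 0 < Re z -> Gamma z = Euler_Gamma z.
Proof. by move=> z0; rewrite /Gamma z0 big_ord0 divr1 addr0. Qed.

Lemma pochE (g : R[i]) (l : R) : 0 < Re g -> 0 <= l ->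
  poch g l = Euler_Gamma (g + l%:C) / Euler_Gamma g.
Proof.
move=> g0 l0; rewrite /poch asboolF.
  by rewrite !GammaE// ReD ltr_wpDr.
by move=> [k gE]; move: g0; rewrite gE ReN Re_nat oppr_gt0 ltNge ler0n.
Qed.

Lemma summable_nsum (T : nat -> nat -> R[i]) :
  summable [set: nat * nat] (fun p : nat * nat => (normc (T p.1 p.2))%:E) ->
  (\sum_(0 <= m <oo) nsum (T m) < +oo)%E.
Proof.
have n0 m n : (0 <= (normc (T m n))%:E)%E by rewrite lee_fin normc_ge0.
rewrite /summable; under eq_esum do rewrite gee0_abs//.
rewrite nneseries_esumT => [|m]; last exact: nsum_ge0.
have -> : \esum_(m in [set: nat]) nsum (T m) =
    \esum_(m in [set: nat]) \esum_(n in [set: nat]) (normc (T m n))%:E.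
  by apply: eq_esum => m _; rewrite /nsum nneseries_esumT.
rewrite esum_esum// (_ : [set: nat] `*`` _ = [set: nat * nat])//.
by apply/seteqP; split.
Qed.

Lemma nsumZ (c : R[i]) (u : nat -> R[i]) :
  (nsum (fun n => c * u n)%R = (normc c)%:E * nsum u)%E.
Proof.
rewrite /nsum -nneseriesZl => [|n _]; last by rewrite lee_fin normc_ge0.
by apply: eq_eseriesr => n _; rewrite Normc.normcM EFinM.
Qed.

Lemma nsum2Z (c : R[i]) (T : nat -> nat -> R[i]) :
  (\sum_(0 <= m <oo) nsum (T m) < +oo)%E ->
  (\sum_(0 <= m <oo) nsum (fun n => c * T m n)%R < +oo)%E.
Proof.
move=> h; under eq_eseriesr do rewrite nsumZ.
rewrite nneseriesZl => [|m _]; last exact: nsum_ge0.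
by rewrite lte_mul_pinfty// lee_fin normc_ge0.
Qed.

Lemma row_nsum (T : nat -> nat -> R[i]) m :
  (\sum_(0 <= k <oo) nsum (T k) < +oo)%E -> (nsum (T m) < +oo)%E.
Proof.
apply: le_lt_trans.
apply: le_trans (nneseries_lim_ge m.+1 (fun k _ _ => nsum_ge0 (T k))).
have n0 k : (0 <= nsum (T k))%E by exact: nsum_ge0.
by rewrite big_nat_recr//= leeDr// sume_ge0.
Qed.

Definition csum2 (T : nat -> nat -> R[i]) := csum (fun m => csum (T m)).

Lemma csum2Z (c : R[i]) (T : nat -> nat -> R[i]) :
  (\sum_(0 <= m <oo) nsum (T m) < +oo)%E ->
  csum2 (fun m n => c * T m n) = c * csum2 T.
Proof.
move=> h; rewrite /csum2 -csumZ.
  by congr csum; apply/funext => m; rewrite csumZ//; exact: row_nsum h.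
apply: (le_lt_trans _ h); apply: lee_nneseries => m _.
  by rewrite lee_fin normc_ge0.
by apply: normc_csum; exact: row_nsum h.
Qed.

Lemma cintegral_beta_kernel (p q : R[i]) :
  cintegral `]0, 1[ (beta_kernel p q) = cBeta p q.
Proof.
rewrite cintegral_mkcond; apply: eq_cintegral => t _.
by rewrite mem_setE in_itv/= /beta_kernel; case: (_ && _).
Qed.

(** Writing both beta integrals as quotients of Gamma values, the bound asks that
    [Euler_Gamma (p + l)] be not much smaller than its integral of moduli,
    uniformly in [l]: this is [Euler_Gamma_lower]. *)
Lemma absBeta_le (p q : R[i]) : 0 < Re p -> 0 < Re q -> exists2 K : R, 0 <= K &
  forall l, 0 <= l -> (absBeta (p + l%:C)%R q <= (K * normc (cBeta (p + l%:C) q))%:E)%E.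
Proof.
move=> p0 q0; have [c c0 hc] := Euler_Gamma_lower (Im p) p0.
have gq0 : 0 < normc (Euler_Gamma q).
  rewrite lt_neqAle normc_ge0 andbT eq_sym; apply/eqP => /Normc.eq0_normc/eqP.
  by apply/negP; exact: Euler_Gamma_neq0.
have aq0 := realGamma_gt0 q0.
exists (2 * realGamma (Re q) / (c * normc (Euler_Gamma q))).
  by rewrite divr_ge0// mulr_ge0// ltW.
move=> l l0; set z := p + l%:C.
have z0 : 0 < Re z by rewrite ReD ltr_wpDr.
have zq0 : 0 < Re (z + q) by rewrite ReD addr_gt0.
have fB : absBeta z q \is a fin_num.
  rewrite ge0_fin_numE ?absBeta_fin//; apply: integral_ge0 => t _.
  by rewrite lee_fin normc_ge0.
have rE (w : R[i]) : 0 < Re w -> absGamma w = (realGamma (Re w))%:E.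
  by move=> w0; rewrite absGamma_Re /realGamma fineK// absGamma_fin.
have := absGamma_absBeta z q; rewrite !rE// -(fineK fB) -!EFinM => -[hA].
have := congr1 (@Normc.normc _) (Gamma_Beta z0 q0); rewrite !Normc.normcM => hB.
have azq0 := realGamma_gt0 zq0.
have up := Euler_Gamma_upper zq0.
have lo : c * realGamma (Re z) <= normc (Euler_Gamma z).
  have := hc (Re z); rewrite [X in normc (Euler_Gamma X)](_ : _ = z).
    by apply; rewrite ReD lerDl.
  by apply: complex_ext => //=; rewrite ImD addr0.
rewrite lee_fin; move: gq0 aq0 azq0 up lo hA hB.
set gq := normc (Euler_Gamma q); set gz := normc (Euler_Gamma z).
set gzq := normc (Euler_Gamma (z + q)); set B := normc (cBeta z q).
set aB := fine _; set aq := realGamma (Re q); set az := realGamma (Re z).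
set azq := realGamma _ => gq0 aq0 azq0 up lo hA hB.
have B0 : 0 <= B by exact: normc_ge0.
rewrite mulrAC ler_pdivlMr ?mulr_gt0// -(ler_pM2l azq0).
have -> : azq * (aB * (c * gq)) = (c * az) * (aq * gq).
  by rewrite mulrA -hA; ring.
apply: (@le_trans _ _ (gz * (aq * gq))).
  by rewrite ler_wpM2r// mulr_ge0// ltW.
have -> : gz * (aq * gq) = aq * (gzq * B) by rewrite -hB; ring.
have -> : azq * (2 * aq * B) = aq * (2 * azq * B) by ring.
by rewrite ler_wpM2l ?(ltW aq0)// ler_wpM2r.
Qed.

End Representation.

Theorem mainTheorem3 (R : realType)
    (g1 g2 g3 d1 d2 d3 x y mu : R[i])
    (a1 a2 a3 a4 b1 b2 b3 b4 : R)
    (a1_gt0 : 0 < a1) (a2_gt0 : 0 < a2) (a3_gt0 : 0 < a3) (a4_gt0 : 0 < a4)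
    (b1_gt0 : 0 < b1) (b2_gt0 : 0 < b2) (b3_gt0 : 0 < b3) (b4_gt0 : 0 < b4)
    (g3_gt0 : 0 < complex.Re g3) (mu_gt_g3 : complex.Re g3 < complex.Re mu)
    (lhs_cvg : D1_abs_cvg g1 a1 b1 g2 a2 g3 b2 d1 a3 b3 d2 a4 d3 b4 x y)
    (rhs_cvg : forall xi : R, 0 < xi < 1 ->
       D1_abs_cvg g1 a1 b1 g2 a2 mu b2 d1 a3 b3 d2 a4 d3 b4
         x (y * (xi `^ b2)%:C)) :
  let F (xi : R) : R[i] :=
    cpow xi (g3 - 1) * cpow (1 - xi) (mu - g3 - 1) *
    D1 g1 a1 b1 g2 a2 mu b2 d1 a3 b3 d2 a4 d3 b4 x (y * (xi `^ b2)%:C) in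
  cintegrable `]0, 1[ F /\
  D1 g1 a1 b1 g2 a2 g3 b2 d1 a3 b3 d2 a4 d3 b4 x y =
    Gamma mu / (Gamma g3 * Gamma (mu - g3)) * cintegral `]0, 1[ F.
Proof.
move=> F; set q := mu - g3.
have q0 : 0 < Re q by rewrite ReD ReN subr_gt0.
have mu0 : 0 < Re mu by exact: lt_trans mu_gt_g3.
have lam0 n : 0 <= b2 * n%:R by rewrite mulr_ge0 ?(ltW b2_gt0)// ler0n.
have g3n0 := Euler_Gamma_neq0 g3_gt0; have qn0 := Euler_Gamma_neq0 q0.
have mun0 := Euler_Gamma_neq0 mu0.
pose L m n := D1_term g1 a1 b1 g2 a2 g3 b2 d1 a3 b3 d2 a4 d3 b4 x y m n.
pose C v m n := D1_term g1 a1 b1 g2 a2 mu b2 d1 a3 b3 d2 a4 d3 b4 x v m n.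
pose kappa := Euler_Gamma g3 * Euler_Gamma q / Euler_Gamma mu.
pose B n := cBeta (g3 + (b2 * n%:R)%:C) q.
pose f m n t := C y m n * beta_kernel (g3 + (b2 * n%:R)%:C) q t.
(* Integrating against the beta kernel turns the symbol of mu into that of g3. *)
have CB m n : C y m n * B n = kappa * L m n.
  have p0 : 0 < Re (g3 + (b2 * n%:R)%:C) by rewrite ReD /= ltr_wpDr.
  have mul0 : 0 < Re (mu + (b2 * n%:R)%:C) by rewrite ReD /= ltr_wpDr.
  have := Gamma_Beta p0 q0.
  have -> : g3 + (b2 * n%:R)%:C + q = mu + (b2 * n%:R)%:C by rewrite /q; ring.
  have muln0 := Euler_Gamma_neq0 mul0.
  move=> GB; have -> : B n = Euler_Gamma (g3 + (b2 * n%:R)%:C) * Euler_Gamma q /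
      Euler_Gamma (mu + (b2 * n%:R)%:C) by rewrite GB mulrC mulKf.
  rewrite /C /L /D1_term (pochE mu0 (lam0 n)) (pochE g3_gt0 (lam0 n)) /kappa.
  set X := (Gamma (d1 + _))^-1; set Y := x ^+ m / _; set Z := y ^+ n / _.
  by field; rewrite ?g3n0 ?mun0 ?muln0.
(* The factor t ^ (b2 n) of the term is absorbed by the beta kernel. *)
have fE m n (t : R) : 0 < t < 1 ->
    f m n t = beta_kernel g3 q t * C (y * (t `^ b2)%:C) m n.
  move=> t01; have [t0 t1] := andP t01.
  have pw : ((t `^ b2)%:C : R[i]) ^+ n = cpow t (b2 * n%:R)%:C.
    rewrite cpow_real -rmorphXn; congr (_%:C).
    by rewrite /powR gt_eqF//= -expRM_natr; congr expR; ring.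
  rewrite /f /C /D1_term exprMn pw /beta_kernel t0 t1 /=.
  have -> : g3 + (b2 * n%:R)%:C - 1 = (g3 - 1) + (b2 * n%:R)%:C by ring.
  by rewrite cpowD; ring.
have inD (t : R) : `]0, 1[%classic t -> 0 < t < 1 by rewrite /= in_itv/=.
have Lsum := summable_nsum lhs_cvg.
have Csum (t : R) : 0 < t < 1 ->
    (\sum_(0 <= m <oo) nsum (C (y * (t `^ b2)%:C)%R m) < +oo)%E.
  by move=> t01; exact: summable_nsum (rhs_cvg t t01).
have [] := @cintegral_csum2 R `]0, 1[ (measurable_itv _) f.
- move=> m n; apply: cmeasurableM; first exact: cmeasurable_cst.
  have [m1 m2] := cmeasurable_beta_kernel (g3 + (b2 * n%:R)%:C) q.
  by split; exact: measurable_funTS.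
- move=> t /inD t01.
  under eq_eseriesr do under eq_fun do rewrite fE//.
  exact: nsum2Z (Csum t t01).
  (* The integral of |f m n| is at most K |kappa| |L m n|. *)
- have [K K0 hK] := absBeta_le g3_gt0 q0.
  have : (\sum_(0 <= m <oo) nsum (fun n => (K%:C * kappa) * L m n)%R < +oo)%E.
    exact: nsum2Z Lsum.
  apply: le_lt_trans; apply: lee_nneseries => m _.
    move=> _; apply: nneseries_ge0 => n _ _; apply: integral_ge0 => t _.
    by rewrite lee_fin normc_ge0.
  apply: lee_nneseries => n _.
    by move=> _; apply: integral_ge0 => t _; rewrite lee_fin normc_ge0.
  have mb : measurable_fun setT
      (fun t : R => (normc (beta_kernel (g3 + (b2 * n%:R)%:C) q t))%:E).
    by apply/measurable_EFinP/measurable_normc; exact: cmeasurable_beta_kernel.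
  rewrite -mulrA -CB Normc.normcM (Normc.normcM (C y m n)) normc_real (ger0_norm K0)
    mulrCA EFinM.
  under eq_integral do rewrite /f Normc.normcM EFinM.
  rewrite ge0_integralZl//; last 3 first.
  - exact: measurable_funTS.
  - by move=> t _; rewrite lee_fin normc_ge0.
  - by rewrite lee_fin normc_ge0.
  apply: lee_wpmul2l; first by rewrite lee_fin normc_ge0.
  apply: le_trans (hK _ (lam0 n)).
  by apply: ge0_subset_integral => // t _; rewrite lee_fin normc_ge0.
move=> intF EF.
have FE (t : R) : `]0, 1[%classic t ->
    csum (fun m => csum (fun n => f m n t)) = F t.
  move=> /inD t01; have [t0 t1] := andP t01.
  transitivity (csum2 (fun m n => beta_kernel g3 q t * C (y * (t `^ b2)%:C) m n)).
    by congr csum; apply/funext => m; congr csum; apply/funext => n; exact: fE.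
  rewrite csum2Z; last exact: Csum.
  by rewrite /F /beta_kernel t01.
split; first exact: eq_cintegrable FE intF.
rewrite -(eq_cintegral FE) -EF.
transitivity (Gamma mu / (Gamma g3 * Gamma q) * (kappa * csum2 L)).
  rewrite !GammaE// /kappa -[LHS]/(csum2 L); field.
  by rewrite g3n0 qn0 mun0.
congr (_ * _); rewrite -csum2Z//.
congr csum; apply/funext => m; congr csum; apply/funext => n.
rewrite -CB /f cintegralZ ?cintegral_beta_kernel//.
have p0 : 0 < Re (g3 + (b2 * n%:R)%:C) by rewrite ReD /= ltr_wpDr.
have [i1 i2] := cintegrable_beta_kernel p0 q0.
by split; [apply: integrableS i1|apply: integrableS i2].
Qed.
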